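(* Suppose that $I\subset S$ is a homogeneous ideal, let $p$ be an integer and set $m= t_p(S/I)$. Let $L \subset S$ be any ideal generated by $n-p$ independent linear forms. If $I+L$ contains a power of $\mathfrak m$ (which will always be true if $K$ is infinite, $L$ is general and $p \leq \operatorname{codim} I$), then $I+L$ contains $\mathfrak m^{m-p+1}$, and more generally $$\mathfrak m^{m-p+s}\subset I+L^s\qquad\text{for } s\ge 1.$$ For example, if $I+L$ contains a power of $\mathfrak m$, $I$ is generated in degree $d$ and the minimal free resolution of $I$ is linear for $p-1$ steps, then $$\mathfrak m^d\subset I+L.$$
   Context: $K$ is a field, $S=K[x_1,\dots,x_n]$ is the polynomial ring graded with $\deg x_i=1$, and $\mathfrak m=(x_1,\dots,x_n)$. $\operatorname{codim} I=n-\dim S/I$. For a finitely generated graded $S$-module $A$, $t_p(A)=\sup\{i\mid \operatorname{Tor}^S_p(A,K)_i\ne 0\}$, the maximal degree of a minimal generator of the $p$-th syzygies of $A$. The resolution of an ideal $I$ generated in degree $d$ is linear for $q$ steps ($q\geq 0$) if for $0\le i\le q$ the $i$-th free module in the minimal graded free resolution of $I$ (as a module, starting with $i=0$ for the generators) is generated in degree $d+i$. *)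

(* Defs.v *)
(* mpoly must be imported before the analysis files: in the opposite order
   their notation levels clash. *)
From HB Require Import structures.
From mathcomp Require Import all_boot all_order all_algebra.
From mathcomp Require Import mpoly.
From mathcomp Require Import boolp classical_sets functions cardinality.
From mathcomp Require Import constructive_ereal.
Set Implicit Arguments.
Unset Strict Implicit.
Unset Printing Implicit Defensive.
Import Order.TTheory GRing.Theory Num.Theory.
Local Open Scope ring_scope.
Local Open Scope classical_set_scope.

(* Least upper bound of a set of integers in the extended integers; it is -oo
   for the empty set. *)
Definition is_sup (A : set int) (x : \bar int) : Prop :=
  (forall i, A i -> (i%:E <= x)%E) /\
  (forall y : \bar int, (forall i, A i -> (i%:E <= y)%E) -> (x <= y)%E).

Section Ideals.
Variables (K : fieldType) (n : nat).
Local Notation S := {mpoly K[n]}.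
Implicit Types (I J P : set S).

Definition is_ideal I : Prop :=
  [/\ I 0, forall f g, I f -> I g -> I (f + g) & forall f g, I g -> I (f * g)].

Definition homogeneous_ideal I : Prop :=
  is_ideal I /\ forall f (d : nat), I f -> I (pihomog mdeg d f).

Definition ideal_gen (X : set S) : set S :=
  [set f | exists k (c x : 'I_k -> S),
     (forall i, X (x i)) /\ f = \sum_(i < k) c i * x i].

Definition ideal_add I J : set S := [set f + g | f in I & g in J].

Definition ideal_mul I J : set S := ideal_gen [set f * g | f in I & g in J].

Fixpoint ideal_pow I (k : nat) : set S :=
  match k with
  | 0 => setT
  | 1 => I
  | k'.+1 => ideal_mul I (ideal_pow I k')
  end.

(* Powers with an extended integer exponent: all nonpositive powers are the
   unit ideal. The exponent +oo never arises from a finitely generated module. *)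
Definition ideal_powe I (e : \bar int) : set S :=
  match e with
  | EFin (Posz k) => ideal_pow I k
  | EFin (Negz _) => setT
  | -oo%E => setT
  | +oo%E => [set 0]
  end.

Definition irrelevant_ideal : set S := ideal_gen (range (fun i : 'I_n => 'X_i)).

Definition contains_irrelevant_power I : Prop :=
  exists N : nat, ideal_pow irrelevant_ideal N `<=` I.

Definition generated_in_degree (d : nat) I : Prop :=
  I = ideal_gen [set f | I f /\ f \is d.-homog].

Definition independent_forms (r : nat) (l : 'I_r -> S) : Prop :=
  (forall i, l i \is 1.-homog) /\
  (forall c : 'I_r -> K, \sum_(i < r) c i *: l i = 0 -> forall i, c i = 0).

(* The linear forms whose coefficient vectors are the rows of C. *)
Definition forms_of_mx (r : nat) (C : 'M[K]_(r, n)) : 'I_r -> S :=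
  fun i => \sum_(j < n) C i j *: 'X_j.

(* P holds on a nonempty (when K is infinite) Zariski-open subset of the affine
   space of r-tuples of linear forms. *)
Definition for_general_forms (r : nat) (P : ('I_r -> S) -> Prop) : Prop :=
  exists2 Phi : {mpoly K[r * n]}, Phi != 0 &
    forall C : 'M[K]_(r, n),
      Phi.@[fun k => mxvec C 0 k] != 0 -> P (forms_of_mx C).

Definition prime_ideal P : Prop :=
  [/\ is_ideal P, ~ P 1 & forall f g, P (f * g) -> P f \/ P g].

(* Lengths of the chains of primes of S/I, seen as primes of S containing I. *)
Definition prime_chain_length I : set int :=
  [set z | exists (k : nat) (P : nat -> set S),
     [/\ z = k%:Z,
         forall i, (i <= k)%N -> prime_ideal (P i) /\ I `<=` P i &
         forall i, (i < k)%N -> P i `<` P i.+1]].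

Definition is_dim_quotient I (D : \bar int) : Prop :=
  is_sup (prime_chain_length I) D.

(* For I = S the dimension of the zero ring is -oo and the codimension +oo. *)
Definition is_codim I (c : \bar int) : Prop :=
  exists2 D, is_dim_quotient I D & c = (n%:Z%:E - D)%E.

(* A sequence ... -> F_1 -> F_0 of graded free modules of finite rank with a map
   F_0 -> S. Elements are row vectors, matrices act on the right, and grdeg i j
   is the degree of the j-th basis element of F_i. *)
Record graded_sequence := GradedSequence {
  grrank : nat -> nat;
  grdeg : forall i, 'I_(grrank i) -> int;
  grdiff : forall i, 'M[S]_(grrank i.+1, grrank i);
  graug : 'cV[S]_(grrank 0) }.

Definition homog_of_degree (e : int) (f : S) : Prop :=
  forall m, m \in msupp f -> (mdeg m)%:Z = e.

(* F is a graded free resolution of the module U/J, for ideals J `<=` U of S: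
   the composite F_0 -> U -> U/J is onto, and its kernel is the preimage of J
   under F_0 -> U. Thus (U, J) = (S, I) gives resolutions of S/I and
   (U, J) = (I, 0) gives resolutions of I. *)
Definition graded_free_resolution (U J : set S) (F : graded_sequence) : Prop :=
  [/\ forall j, homog_of_degree (grdeg j) (graug F j 0),
      forall i j k, homog_of_degree (grdeg j - grdeg k) (grdiff F i j k),
      U = ideal_add [set (v *m graug F) 0 0 | v in [set: 'rV[S]_(grrank F 0)]] J,
      forall v : 'rV[S]_(grrank F 0),
       J ((v *m graug F) 0 0) <-> exists w, v = w *m grdiff F 0 &
      forall i (v : 'rV[S]_(grrank F i.+1)),
       v *m grdiff F i = 0 <-> exists w, v = w *m grdiff F i.+1].

Definition minimal_resolution (U J : set S) (F : graded_sequence) : Prop :=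
  graded_free_resolution U J F /\
  forall i j k, irrelevant_ideal (grdiff F i j k).

(* The differential of F (x)_S K, where K = S / (x_1, ..., x_n). *)
Definition diff_tensor_K (F : graded_sequence) (i : nat) :
    'M[K]_(grrank F i.+1, grrank F i) :=
  map_mx (fun f : S => f@_0%MM) (grdiff F i).

Definition tensor_K_cycle (F : graded_sequence) (p : nat) :
    'rV[K]_(grrank F p) -> Prop :=
  match p return 'rV[K]_(grrank F p) -> Prop with
  | 0 => fun _ => True
  | q.+1 => fun v => v *m diff_tensor_K F q = 0
  end.

(* H_p (F (x)_S K) is nonzero in degree e. When F is a graded free resolution
   of A, this homology is Tor_p^S(A, K). *)
Definition Tor_neq0 (F : graded_sequence) (p : nat) (e : int) : Prop :=
  exists v : 'rV[K]_(grrank F p),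
    [/\ forall j, grdeg j != e -> v 0 j = 0,
        tensor_K_cycle v &
        ~ exists w, v = w *m diff_tensor_K F p].

(* t is t_p(U/J), the Tor being computed from the resolution F of U/J. *)
Definition is_t (U J : set S) (F : graded_sequence) (p : nat) (t : \bar int) :
    Prop :=
  graded_free_resolution U J F /\ is_sup [set e | Tor_neq0 F p e] t.

(* The minimal resolution F of an ideal generated in degree d is linear for q
   steps. *)
Definition linear_for_steps (F : graded_sequence) (d q : nat) : Prop :=
  forall i, (i <= q)%N -> forall j : 'I_(grrank F i), grdeg j = (d + i)%N%:Z.

End Ideals.

Arguments irrelevant_ideal {K n}.

(* Main.v *)
Require Import Defs.
From HB Require Import structures.
From mathcomp Require Import all_boot all_order all_algebra.
From mathcomp Require Import mpoly.
From mathcomp Require Import boolp classical_sets functions cardinality.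
From mathcomp Require Import constructive_ereal.
From mathcomp Require Import zify ring.
Set Implicit Arguments.
Unset Strict Implicit.
Unset Printing Implicit Defensive.
Import Order.TTheory GRing.Theory Num.Theory.
Local Open Scope ring_scope.
Local Open Scope classical_set_scope.

(** Write A = S/I, let F be a graded free resolution of A and t a bound for the
degrees in which Tor_p(A, K) lives.

The first assertion is a statement about top degrees: if S/(I + L) has finite
length, a form of degree c >= t - p + s lies in I + L^s. Complete the
generators of L by linear forms y_1, ..., y_p to a basis of the space of linear
forms. As I + L contains a power of the irrelevant ideal, some power y_j^N lies
in I + L^s for every j. Put J_k = L^s + (y_1^N, ..., y_k^N). The proof follows
Tor_k(A, S/J_k) in degree c + kN as k decreases from p to 0; the vanishing of
this Tor is [exact_mod F J_k k (c + kN)].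

- For k = p ([exact_mod_pullback]): S/J_p is spanned by monomials of degree at
  most (s - 1) + p(N - 1), so it is an iterated extension of shifts of K, and
  Tor_p(A, S/J_p) vanishes above degree t + (s - 1) + p(N - 1).
- From k + 1 to k ([exact_mod_descent]): y_{k+1}^N is regular on S/J_k and
  kills Tor_k(A, S/J_k), because it lies in I + J_k, and both I and J_k kill
  this module. In the long exact sequence of multiplication by y_{k+1}^N on
  S/J_k, the connecting map Tor_{k+1}(A, S/J_{k+1}) -> Tor_k(A, S/J_k)(-N) is
  therefore onto, and the vanishing descends.
- For k = 0: the degree c part of S/(I + L^s) = Tor_0(A, S/L^s) is zero.

All these Tor modules are handled through cycles and boundaries modulo an ideal,
so neither long exact sequences nor tensor products of complexes are
constructed. The ideals J_k are monomial in the coordinates given by the basis,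
and regularity and the filtration of S/J_p become statements on monomials.
When Tor_p(A, K) = 0 the bound t can be taken arbitrarily negative, and the same
argument shows that I + L^s is the unit ideal.

The assertion on linear resolutions is the case s = 1: a resolution of I that is
linear for p - 1 steps, shifted by one and augmented by S, shows that
Tor_p(A, K) lives in degree d + p - 1.

For general linear forms, let r = n - p and call I uncut if S/(I + L) has
infinite length for all ideals L generated by r linear forms. If one L cuts
S/I down to finite length, so do all those where a certain determinant in the
coefficients does not vanish ([cuts_open]). It remains to show that an uncut I
has a chain of r + 2 primes above it ([uncut_chain]), since this forces
codim I < p. A homogeneous ideal P containing I and maximal among the uncut ones
is prime ([uncut_prime]): if P + (f) and P + (g) are cut, then over an infinite
field they are cut by a common L, hence so is P + (fg). A variable outside P
gives an ideal P + (x_k) that is uncut for r - 1 forms, and the chain is built by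
induction on r, ending with the irrelevant ideal. *)

(** * Ideals and their powers *)

Section IdealTheory.
Variables (K : fieldType) (n : nat).
Local Notation S := {mpoly K[n]}.
Implicit Types (I J : set S) (f g : S).

Lemma idealMr I f g : is_ideal I -> I f -> I (f * g).
Proof. by case=> _ _ IM If; rewrite mulrC; apply: IM. Qed.

Lemma idealB I f g : is_ideal I -> I f -> I g -> I (f - g).
Proof. by case=> _ ID IM If Ig; apply: ID => //; rewrite -mulN1r; apply: IM. Qed.

Lemma ideal_sum I (T : Type) (s : seq T) (P : pred T) (F : T -> S) :
  is_ideal I -> (forall i, P i -> I (F i)) -> I (\sum_(i <- s | P i) F i).
Proof. by move=> [I0 ID _]; apply: big_ind. Qed.

Lemma ideal_scale I a f : is_ideal I -> I f -> I (a *: f).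
Proof. by case=> _ _ IM If; rewrite -mul_mpolyC; apply: IM. Qed.

Lemma ideal_gen_ideal (X : set S) : is_ideal (ideal_gen X).
Proof.
split=> [|f g [k [c [x [Xx ->]]]] [k' [c' [x' [Xx' ->]]]]|f g [k [c [x [Xx ->]]]]].
- by exists 0%N, (fun=> 0), (fun=> 0); split; [case | rewrite big_ord0].
- exists (k + k')%N,
    (fun i : 'I_(k + k') => match fintype.split i with inl a => c a | inr b => c' b end),
    (fun i : 'I_(k + k') => match fintype.split i with inl a => x a | inr b => x' b end).
  split=> [i|]; first by case: (fintype.split i).
  rewrite big_split_ord /=; congr (_ + _); apply: eq_bigr => i _.
    by have /= -> := unsplitK (inl i : 'I_k + 'I_k').
  by have /= -> := unsplitK (inr i : 'I_k + 'I_k').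
- exists k, (fun i => f * c i), x; split=> //.
  by rewrite mulr_sumr; apply: eq_bigr => i _; rewrite mulrA.
Qed.

Lemma sub_ideal_gen (X : set S) : X `<=` ideal_gen X.
Proof.
move=> f Xf; exists 1%N, (fun=> 1), (fun=> f); split=> //.
by rewrite big_ord1 mul1r.
Qed.

Lemma ideal_gen_min (X : set S) I :
  is_ideal I -> X `<=` I -> ideal_gen X `<=` I.
Proof.
move=> II XI _ [k [c [x [Xx ->]]]]; apply: ideal_sum => // i _.
by case: II => _ _ IM; apply/IM/XI.
Qed.

Lemma ideal_gen_range (T : finType) (F : T -> S) f :
  ideal_gen (range F) f -> exists c : T -> S, f = \sum_i c i * F i.
Proof.
apply: (@ideal_gen_min _ [set g | exists c : T -> S, g = \sum_i c i * F i])
  => [|_ [i _ <-]].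
  split=> [|_ _ [c ->] [c' ->]|g _ [c ->]].
  - by exists (fun=> 0); rewrite big1 // => i _; rewrite mul0r.
  - exists (fun i => c i + c' i); rewrite -big_split.
    by apply: eq_bigr => i _; rewrite mulrDl.
  - by exists (fun i => g * c i); rewrite mulr_sumr; apply: eq_bigr => i _; rewrite mulrA.
exists (fun j => (j == i)%:R); rewrite (bigD1 i) //= eqxx mul1r big1 ?addr0 //.
by move=> j /negPf ->; rewrite mul0r.
Qed.

Lemma ideal_add_ideal I J : is_ideal I -> is_ideal J -> is_ideal (ideal_add I J).
Proof.
case=> [I0 ID IM] [J0 JD JM]; split.
- by exists 0 => //; exists 0 => //; rewrite addr0.
- move=> _ _ [f If [g Jg <-]] [f' If' [g' Jg' <-]].
  exists (f + f'); first exact: ID.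
  by exists (g + g'); [exact: JD | rewrite addrACA].
- move=> h _ [f If [g Jg <-]]; exists (h * f); first exact: IM.
  by exists (h * g); [exact: JM | rewrite mulrDr].
Qed.

Lemma sub_ideal_addl I J : is_ideal J -> I `<=` ideal_add I J.
Proof. by case=> J0 _ _ f If; exists f => //; exists 0; rewrite ?addr0. Qed.

Lemma sub_ideal_addr I J : is_ideal I -> J `<=` ideal_add I J.
Proof. by case=> I0 _ _ f Jf; exists 0 => //; exists f; rewrite ?add0r. Qed.

Lemma ideal_add_min I J I' :
  is_ideal I' -> I `<=` I' -> J `<=` I' -> ideal_add I J `<=` I'.
Proof. by case=> _ ID _ sI sJ _ [f If [g Jg <-]]; apply: ID; [apply: sI|apply: sJ]. Qed.

Lemma ideal_powS I k f g :
  is_ideal I -> I f -> ideal_pow I k g -> ideal_pow I k.+1 (f * g).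
Proof.
case: k => [|k] II If; first by move=> _; apply: idealMr.
by move=> Ig; apply: sub_ideal_gen; exists f => //; exists g.
Qed.

Lemma ideal_pow_ideal I k : is_ideal I -> is_ideal (ideal_pow I k).
Proof. by case: k => [|[|k]] // _; apply: ideal_gen_ideal. Qed.

(** Every bound on the powers of an ideal below comes from this comparison
with a filtration J that is multiplicative on the left by J 1. *)
Lemma ideal_pow_min (J : nat -> set S) I :
  (forall k, is_ideal (J k)) -> J 0%N = setT -> I `<=` J 1%N ->
  (forall k f g, J 1%N f -> J k g -> J k.+1 (f * g)) ->
  forall k, ideal_pow I k `<=` J k.
Proof.
move=> iJ J0 IJ JS; elim=> [|[|k] IHk] //; first by rewrite J0.
apply: ideal_gen_min => // _ [f If [g Ig <-]].
by apply: JS; [apply: IJ | apply: IHk].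
Qed.

Lemma ideal_pow_exp I f k : is_ideal I -> I f -> ideal_pow I k (f ^+ k).
Proof.
by move=> II If; elim: k => // k IHk; rewrite exprS; apply: ideal_powS.
Qed.

(** Modulo I the element f is congruent to an element of J. *)
Lemma ideal_add_exp I J f k :
  is_ideal I -> is_ideal J -> ideal_add I J f ->
  ideal_add I (ideal_pow J k) (f ^+ k).
Proof.
move=> II IJ [a Ia [b Jb <-]]; elim: k => [|k [u Iu [v Jv eq_k]]].
  by apply: sub_ideal_addr.
exists (a * (a + b) ^+ k + b * u).
  by case: (II) => _ ID IM; apply: ID; [apply: idealMr | apply: IM].
exists (b * v); first exact: ideal_powS.
by rewrite exprS -eq_k; ring.
Qed.

End IdealTheory.

(** * Monomial spans and homogeneous parts *)

Section Monomials.
Variables (K : fieldType) (n : nat).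
Local Notation S := {mpoly K[n]}.
Implicit Types (I J : set S) (f g : S) (U V : pred 'X_{1..n}).

Definition monomial_span U : set S := [set f | forall m, f@_m != 0 -> U m].

Definition mupclosed U := forall m m', U m -> U (m + m')%MM.

Lemma mcoeffM_neq0 f g m :
  (f * g)@_m != 0 -> exists a b, [/\ m = (a + b)%MM, f@_a != 0 & g@_b != 0].
Proof.
rewrite -mcoeff_msupp => /msuppM_le /allpairsP[[a b] /= [fa gb ->]].
by exists a, b; rewrite -!mcoeff_msupp.
Qed.

Lemma monomial_spanM U V (W : pred 'X_{1..n}) f g :
  (forall a b, U a -> V b -> W (a + b)%MM) ->
  monomial_span U f -> monomial_span V g -> monomial_span W (f * g).
Proof.
by move=> UVW Uf Vg m /mcoeffM_neq0[a [b [-> /Uf Ua /Vg Vb]]]; apply: UVW.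
Qed.

Lemma monomial_spanX U m : U m -> monomial_span U 'X_[m].
Proof. by move=> Um m'; rewrite mcoeffX; have [<-|] := eqVneq m m'; rewrite ?eqxx. Qed.

Lemma monomial_span_ideal U : mupclosed U -> is_ideal (monomial_span U).
Proof.
move=> upU; split=> [m|f g Uf Ug m|f g Ug].
- by rewrite mcoeff0 eqxx.
- rewrite mcoeffD => nz; have [/eqP f0|/Uf //] := boolP (f@_m == 0).
  by apply: Ug; rewrite f0 add0r in nz.
- apply: (@monomial_spanM predT U) => // a b _ Ub.
  by rewrite addmC; apply: upU.
Qed.

Lemma monomial_span_sub U I :
  is_ideal I -> (forall m, U m -> I 'X_[m]) -> monomial_span U `<=` I.
Proof.
move=> II UI f Uf; rewrite [f]mpolyE big_seq; apply: ideal_sum => // m.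
by rewrite mcoeff_msupp => /Uf /UI; apply: ideal_scale.
Qed.

(** Homogeneous parts are indexed by integers because the entries of a row of
degree e in a graded free module have degree e minus the degree of a basis
element, which may be negative. *)
Definition hpart (z : int) f : S :=
  if z is Posz d then pihomog mdeg d f else 0.

Lemma mcoeff_hpart z f m :
  (hpart z f)@_m = if (mdeg m)%:Z == z then f@_m else 0.
Proof.
case: z => [d|d] /=; last by rewrite mcoeff0.
elim/mpolyind: f => [|c k f _ _ IHf]; first by rewrite linear0 mcoeff0 if_same.
rewrite linearP /= !mcoeffD IHf !mcoeffZ pihomogX.
have [ed|nd] := eqVneq (mdeg k) d.
  have [//|ne] := eqVneq (mdeg m)%:Z (d%:Z).
  rewrite mcoeffX; case: eqP => [ekm|]; last by rewrite mulr0 addr0.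
  by rewrite -ekm ed eqxx in ne.
rewrite mcoeff0 mulr0 add0r mcoeffX; case: ifP => // /eqP[em].
by case: eqP => [ekm|]; [rewrite ekm em eqxx in nd | rewrite mulr0 add0r].
Qed.

Lemma hpart_homog z f : homog_of_degree z (hpart z f).
Proof.
by move=> m; rewrite mcoeff_msupp mcoeff_hpart; case: ifP => [/eqP //|]; rewrite eqxx.
Qed.

Lemma hpart_id z f : homog_of_degree z f -> hpart z f = f.
Proof.
move=> hf; apply/mpolyP => m; rewrite mcoeff_hpart; case: eqP => // ne.
by apply/esym/eqP; rewrite mcoeff_eq0; apply/negP => /hf.
Qed.

Lemma hpart0 z : hpart z 0 = 0.
Proof. by apply/mpolyP => m; rewrite mcoeff_hpart mcoeff0 if_same. Qed.

Lemma hpartD z f g : hpart z (f + g) = hpart z f + hpart z g.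
Proof.
by apply/mpolyP => m; rewrite !(mcoeffD, mcoeff_hpart); case: ifP; rewrite ?addr0.
Qed.

Lemma hpart_sum z (T : Type) (s : seq T) (P : pred T) (F : T -> S) :
  hpart z (\sum_(i <- s | P i) F i) = \sum_(i <- s | P i) hpart z (F i).
Proof.
by apply: (big_morph (hpart z)); [apply: hpartD | apply: hpart0].
Qed.

(** Homogeneous maps commute with the passage to homogeneous parts. *)
Lemma hpartM z a f g :
  homog_of_degree a g -> hpart z (f * g) = hpart (z - a) f * g.
Proof.
move=> hg; apply/mpolyP => m; rewrite mcoeff_hpart !mcoeffM.
have degg k : g@_k != 0 -> (mdeg k)%:Z = a by rewrite -mcoeff_msupp => /hg.
case: ifP => [/eqP em|ne]; last apply/esym/big1.
  apply: eq_bigr => -[k1 k2] /= /eqP /(congr1 mdeg); rewrite mdegD => ek.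
  have [-> | /degg ea] := eqVneq g@_k2 0; first by rewrite !mulr0.
  by rewrite mcoeff_hpart; have -> : (mdeg k1)%:Z == z - a by lia.
move=> [k1 k2] /= /eqP /(congr1 mdeg); rewrite mdegD => ek.
have [-> | /degg ea] := eqVneq g@_k2 0; first by rewrite mulr0.
rewrite mcoeff_hpart; case: eqP => [ek1|]; last by rewrite mul0r.
by move/eqP: ne; lia.
Qed.

Lemma homog_of_degreeX m : homog_of_degree (mdeg m) ('X_[m] : S).
Proof. by move=> m' /mem_msuppXP <-. Qed.

Lemma homog_of_degreeM a b f g :
  homog_of_degree a f -> homog_of_degree b g -> homog_of_degree (a + b) (f * g).
Proof.
move=> hf hg m /msuppM_le /allpairsP[[k1 k2] /= [/hf <- /hg <- ->]].
by rewrite mdegD PoszD.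
Qed.

Lemma homog_of_degreeXn a f k :
  homog_of_degree a f -> homog_of_degree (a *+ k) (f ^+ k).
Proof.
move=> hf; elim: k => [|k IHk]; last by rewrite exprS mulrS; apply: homog_of_degreeM.
by rewrite expr0 mulr0n -mpolyX0 => m /mem_msuppXP <-; rewrite mdeg0.
Qed.

Lemma homog_of_degree_sum a (T : Type) (s : seq T) (P : pred T) (F : T -> S) :
  (forall i, P i -> homog_of_degree a (F i)) ->
  homog_of_degree a (\sum_(i <- s | P i) F i).
Proof.
move=> hF; apply: big_ind => // [m|f g hf hg m]; first by rewrite msupp0.
by move=> /msuppD_le; rewrite mem_cat => /orP[/hf|/hg].
Qed.

Lemma homog_of_degreeZ a c f : homog_of_degree a f -> homog_of_degree a (c *: f).
Proof. by move=> hf m /msuppZ_le /hf. Qed.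

Lemma homogeneous_hpart I z f : homogeneous_ideal I -> I f -> I (hpart z f).
Proof. by case: z => [d|d] [[I0 _ _] IH] If //; apply: IH. Qed.

Lemma sum_hpart f : f = \sum_(d < msize f) hpart d f.
Proof. exact: pihomog_partitionE. Qed.

End Monomials.

(** * Linear changes of coordinates *)

Section LinearSubstitution.
Variables (K : fieldType) (n : nat).
Local Notation S := {mpoly K[n]}.
Implicit Types (Q : 'M[K]_n) (f g : S).

Definition linsubst Q : S -> S := mmap (@mpolyC n K) (forms_of_mx Q).

HB.instance Definition _ Q := GRing.RMorphism.on (linsubst Q).

Lemma linsubstX Q i : linsubst Q 'X_i = forms_of_mx Q i.
Proof. by rewrite /linsubst mmapX mmap1U. Qed.

Lemma linsubstC Q c : linsubst Q c%:MP = c%:MP.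
Proof. by rewrite /linsubst mmapC. Qed.

Lemma linsubstZ Q c f : linsubst Q (c *: f) = c *: linsubst Q f.
Proof. by rewrite -!mul_mpolyC rmorphM /= linsubstC. Qed.

Lemma linsubstXm Q m : linsubst Q 'X_[m] = \prod_i forms_of_mx Q i ^+ m i.
Proof. exact: mmapX. Qed.

Lemma linsubst_sum Q (T : Type) (s : seq T) (P : pred T) (G : T -> S) :
  linsubst Q (\sum_(i <- s | P i) G i) = \sum_(i <- s | P i) linsubst Q (G i).
Proof. exact: rmorph_sum. Qed.

Lemma forms_of_mx_homog r (C : 'M[K]_(r, n)) i :
  homog_of_degree 1 (forms_of_mx C i).
Proof.
apply: homog_of_degree_sum => j _; apply: homog_of_degreeZ.
by move=> m /mem_msuppXP <-; rewrite mdeg1.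
Qed.

Lemma linsubst_homogX Q m : homog_of_degree (mdeg m) (linsubst Q 'X_[m]).
Proof.
rewrite linsubstXm mdegE.
have : homog_of_degree 0 (1 : S) 
  by rewrite -mpolyX0 => m' /mem_msuppXP <-; rewrite mdeg0.
elim/big_rec2: _ => // i a b _ IHab h1; rewrite PoszD.
apply: homog_of_degreeM; last exact: IHab.
rewrite -[X in Posz X]muln1 mulnC -natz natrM mulr_natr natz.
exact/homog_of_degreeXn/forms_of_mx_homog.
Qed.

Lemma linsubst_hpart Q z f : linsubst Q (hpart z f) = hpart z (linsubst Q f).
Proof.
rewrite [in RHS](mpolyE f) rmorph_sum hpart_sum /=.
have -> : hpart z f = \sum_(m <- msupp f) (if (mdeg m)%:Z == z then f@_m *: 'X_[m] else 0).
  rewrite {1}(mpolyE f) hpart_sum; apply: eq_bigr => m _; apply/mpolyP => k.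
  rewrite mcoeff_hpart mcoeffZ mcoeffX.
  have [<-|ne] := eqVneq m k; first by case: ifP; rewrite ?mcoeffZ ?mcoeffX ?eqxx ?mcoeff0.
  rewrite mulr0 if_same; case: ifP => _; last by rewrite mcoeff0.
  by rewrite mcoeffZ mcoeffX (negPf ne) mulr0.
rewrite rmorph_sum; apply: eq_bigr => m _ /=; rewrite linsubstZ.
have hm : homog_of_degree (mdeg m) (f@_m *: linsubst Q 'X_[m]).
  by apply/homog_of_degreeZ/linsubst_homogX.
case: eqP => [em|ne]; first by rewrite linsubstZ hpart_id // -em.
rewrite rmorph0; apply/esym/mpolyP => k; rewrite mcoeff_hpart mcoeff0.
case: eqP => // ek; apply/eqP; rewrite mcoeff_eq0; apply/negP => /hm ekm.
by case: ne; rewrite -ekm ek.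
Qed.

Lemma linsubst_coeff0 Q f : (linsubst Q f)@_0%MM = f@_0%MM.
Proof.
have part0 g : hpart 0 g = (g@_0%MM)%:MP.
  apply/mpolyP => m; rewrite mcoeff_hpart mcoeffC eqz_nat mdeg_eq0.
  by case: eqP => [->|_]; rewrite ?mulr1 ?mulr0.
have := linsubst_hpart Q 0 f; rewrite !part0 linsubstC.
by move/(congr1 (mcoeff 0%MM)); rewrite !mcoeffC eqxx !mulr1.
Qed.

Lemma linsubstK Q Q' : Q *m Q' = 1%:M -> cancel (linsubst Q) (linsubst Q').
Proof.
move=> QQ' f; rewrite [f]mpolyE (linsubst_sum Q) (linsubst_sum Q').
apply: eq_bigr => m _; rewrite !linsubstZ; congr (_ *: _).
rewrite linsubstXm mpolyXE_id (rmorph_prod (linsubst Q')).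
apply: eq_bigr => i _; rewrite (rmorphXn (linsubst Q')); congr (_ ^+ _).
rewrite /= /forms_of_mx linsubst_sum.
under eq_bigr do rewrite linsubstZ linsubstX /forms_of_mx scaler_sumr.
rewrite exchange_big /=.
transitivity (\sum_k (Q *m Q') i k *: ('X_k : S)).
  by apply: eq_bigr => k _; rewrite mxE scaler_suml; under eq_bigr do rewrite scalerA.
rewrite QQ' (bigD1 i) //= mxE eqxx scale1r big1 ?addr0 // => k /negPf ne.
by rewrite mxE eq_sym ne scale0r.
Qed.

End LinearSubstitution.

(** * Exactness of a resolution modulo an ideal *)

Section Complexes.
Variables (K : fieldType) (n : nat).
Local Notation S := {mpoly K[n]}.
Variables (I : set S) (F : graded_sequence K n).
Hypothesis hI : homogeneous_ideal I.
Hypothesis hF : graded_free_resolution setT I F.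
Implicit Types (J : set S) (f g : S).

Lemma grdiff_homog i j k :
  homog_of_degree (grdeg j - grdeg k) (grdiff F i j k).
Proof. by case: hF. Qed.

Lemma grdiff_exact i (v : 'rV[S]_(grrank F i.+1)) :
  v *m grdiff F i = 0 <-> exists w, v = w *m grdiff F i.+1.
Proof. by case: hF. Qed.

Lemma grdiffK i : grdiff F i.+1 *m grdiff F i = 0.
Proof.
apply/row_matrixP => j; rewrite row0 row_mul; apply/grdiff_exact.
by exists (delta_mx 0 j); rewrite -rowE.
Qed.

Definition rhomog i (e : int) (v : 'rV[S]_(grrank F i)) :=
  forall j, homog_of_degree (e - grdeg j) (v 0 j).

Definition rpart i (e : int) (v : 'rV[S]_(grrank F i)) : 'rV[S]_(grrank F i) :=
  \row_j hpart (e - grdeg j) (v 0 j).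

Lemma rpart_homog i e (v : 'rV_(grrank F i)) : rhomog e (rpart e v).
Proof. by move=> j; rewrite mxE; apply: hpart_homog. Qed.

Lemma rpart_id i e (v : 'rV_(grrank F i)) : rhomog e v -> rpart e v = v.
Proof. by move=> hv; apply/rowP => j; rewrite mxE hpart_id. Qed.

Lemma rpart_diff i e (v : 'rV_(grrank F i.+1)) :
  rpart e (v *m grdiff F i) = rpart e v *m grdiff F i.
Proof.
apply/rowP => k; rewrite !mxE hpart_sum; apply: eq_bigr => j _.
by rewrite (hpartM _ _ (@grdiff_homog i j k)) mxE; congr (hpart _ _ * _); ring.
Qed.

Definition rowin J k (v : 'rV[S]_k) := forall j, J (v 0 j).

Lemma rowinD J k (v w : 'rV[S]_k) :
  is_ideal J -> rowin J v -> rowin J w -> rowin J (v + w).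
Proof. by case=> _ JD _ Jv Jw j; rewrite mxE; apply: JD. Qed.

Lemma rowinM J k k' (v : 'rV[S]_k) (A : 'M_(k, k')) :
  is_ideal J -> rowin J v -> rowin J (v *m A).
Proof. by move=> iJ Jv j; rewrite mxE; apply: ideal_sum => // i _; apply: idealMr. Qed.

Definition cycle_mod J k : 'rV[S]_(grrank F k) -> Prop :=
  match k return 'rV[S]_(grrank F k) -> Prop with
  | 0 => fun _ => True
  | q.+1 => fun w => rowin J (w *m grdiff F q)
  end.

(** This is the vanishing of Tor_k(S/I, S/J) in degree c, in terms of the complex
F modulo J. *)
Definition exact_mod J k (c : int) := forall w : 'rV[S]_(grrank F k),
  rhomog c w -> cycle_mod J w -> exists v, rowin J (w - v *m grdiff F k).

Lemma rows_factor a b c (A : 'M[S]_(a, c)) (B : 'M[S]_(b, c)) :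
  (forall i, exists w, row i A = w *m B) -> exists h, A = h *m B.
Proof.
move=> /choice[h hh]; exists (\matrix_i h i).
by apply/row_matrixP => i; rewrite row_mul rowK.
Qed.

(** An element f of I acts as zero on the homology of F modulo any ideal J.
Multiplication by f lifts the zero map of S/I, so it is null-homotopic, and h is
the component of the homotopy in position k; the first conclusion is what the
construction of the next component needs. *)
Lemma ideal_mul_null_homotopic f k : I f ->
  exists h, grdiff F k *m (f%:M - h *m grdiff F k) = 0 /\
   forall J (w : 'rV_(grrank F k)), is_ideal J -> cycle_mod J w ->
     rowin J (f *: w - w *m h *m grdiff F k).
Proof.
move=> If; elim: k => [|k [h [dh _]]].
  have [h hE] : exists h, f%:M = h *m grdiff F 0.
    apply: rows_factor => i; case: (hF) => _ _ _ ex0 _; apply/ex0.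
    rewrite -row_mul mul_scalar_mx mxE mxE; apply: idealMr => //; by case: hI.
  exists h; rewrite -hE subrr mulmx0; split=> // J w iJ _ j.
  by rewrite -mulmxA -hE mul_mx_scalar subrr mxE; case: iJ.
have [h' hE] : exists h', f%:M - grdiff F k *m h = h' *m grdiff F k.+1.
  apply: rows_factor => i; apply/grdiff_exact; rewrite -row_mul.
  suff -> : (f%:M - grdiff F k *m h) *m grdiff F k = 0 by rewrite row0.
  by rewrite mulmxBl mul_scalar_mx -mulmxA -mul_mx_scalar -mulmxBr.
exists h'; rewrite -hE opprB addrC subrK; split=> [|J w iJ Jw].
  by rewrite mulmxA grdiffK mul0mx.
rewrite -mulmxA -hE mulmxBr mul_mx_scalar opprB addrC subrK mulmxA.
exact: rowinM.
Qed.

Lemma cycle_modW J J' k (w : 'rV_(grrank F k)) :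
  J `<=` J' -> cycle_mod J w -> cycle_mod J' w.
Proof. by move=> JJ'; case: k w => // k w Jw j; apply/JJ'/Jw. Qed.

Lemma cycle_mod_sub_boundary J k (w : 'rV_(grrank F k)) v :
  cycle_mod J w -> cycle_mod J (w - v *m grdiff F k).
Proof. by case: k w v => // k w v Jw j; rewrite mulmxBl -mulmxA grdiffK mulmx0 subr0. Qed.

(** Here J' = J + (y). As y acts as zero on Tor_k(S/I, S/J) and is regular on
S/J, every element w of this Tor comes from Tor_(k+1)(S/I, S/J'): its image under
y is a boundary d v modulo J, and v is a cycle modulo J'. If v is a boundary
modulo J', say v = d v' + y z, then y w is congruent to y d z, and y can be
cancelled. *)
Lemma exact_mod_descent J y (N : nat) k c :
  is_ideal J -> (forall z f, J f -> J (hpart z f)) ->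
  homog_of_degree N y -> ideal_add I J y ->
  (forall f, J (y * f) -> J f) ->
  exact_mod (ideal_add J [set y * f | f in setT]) k.+1 (c + N%:Z) ->
  exact_mod J k c.
Proof.
move=> iJ hJ hy [f If [g Jg ey]] regy ex w hw Jw.
have [h [_ /(_ J w iJ Jw) Jfw]] := ideal_mul_null_homotopic k If.
(* The homotopy need not be homogeneous: its part of the right degree is used. *)
pose v := rpart (c + N%:Z) (w *m h).
have Jyw : rowin J (y *: w - v *m grdiff F k).
  have Jyw0 : rowin J (y *: w - (w *m h) *m grdiff F k).
    rewrite -ey scalerDl addrAC; apply: rowinD => // j.
    by rewrite mxE; apply: idealMr.
  have -> : y *: w = rpart (c + N%:Z) (y *: w).
    rewrite rpart_id // => j; rewrite mxE.
    have -> : c + N%:Z - grdeg j = N%:Z + (c - grdeg j) by ring.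
    exact: homog_of_degreeM.
  move=> j; rewrite -rpart_diff.
  suff -> : (rpart (c + N%:Z) (y *: w) - rpart (c + N%:Z) (w *m h *m grdiff F k)) 0 j
      = hpart (c + N%:Z - grdeg j) ((y *: w - w *m h *m grdiff F k) 0 j).
    exact/hJ/Jyw0.
  rewrite !mxE hpartD; congr (_ + _); apply/mpolyP => m.
  by rewrite mcoeffN !mcoeff_hpart mcoeffN; case: ifP; rewrite ?oppr0.
have [|v' Jv] := ex v (@rpart_homog _ _ _).
  move=> j /=; exists (- (y *: w - v *m grdiff F k) 0 j).
    by rewrite -mulN1r; case: (iJ) => _ _ JM; apply/JM/Jyw.
  by exists (y * w 0 j); [exists (w 0 j) | rewrite !mxE opprB subrK].
have /choice[z hz] : forall j, exists z, J ((v - v' *m grdiff F k.+1) 0 j - y * z).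
  move=> j; have [a Ja [_ [z _ <-] <-]] := Jv j.
  by exists z; rewrite addrK.
pose zr : 'rV[S]_(grrank F k.+1) := \row_j z j.
exists (zr); move=> j; apply: regy.
have Jz : rowin J (v - v' *m grdiff F k.+1 - y *: zr) by move=> i; have := hz i; rewrite !mxE.
have := rowinD iJ Jyw (rowinM (grdiff F k) iJ Jz).
have -> : y *: w - v *m grdiff F k + (v - v' *m grdiff F k.+1 - y *: zr) *m grdiff F k
    = y *: (w - zr *m grdiff F k).
  rewrite !mulmxBl -mulmxA grdiffK mulmx0 subr0 -scalemxAl scalerBr.
  by rewrite addrA subrK.
by move/(_ j); rewrite mxE.
Qed.

End Complexes.

(** * Vanishing of Tor with a quotient of finite length *)

Section TopOfTor.
Variables (K : fieldType) (n : nat).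
Local Notation S := {mpoly K[n]}.
Variables (I : set S) (F : graded_sequence K n).
Hypothesis hF : graded_free_resolution setT I F.
Variables (Q Q' : 'M[K]_n).
Hypothesis Q'Q : Q' *m Q = 1%:M.

(** If Q is inverse to the matrix of a basis of linear forms, this is the span of
the monomials of U in that basis. *)
Definition pullback (U : pred 'X_{1..n}) : set S :=
  [set f | monomial_span U (linsubst Q f)].

Lemma pullback_ideal U : mupclosed U -> is_ideal (pullback U).
Proof.
move=> /(monomial_span_ideal K)[U0 UD UM]; rewrite /pullback; split=> [|f g Uf Ug|f g Ug] /=.
- by rewrite rmorph0.
- by rewrite rmorphD; apply: UD.
- by rewrite rmorphM; apply: UM.
Qed.

Lemma pullback_hpart U z f : pullback U f -> pullback U (hpart z f).
Proof.
move=> Uf m; rewrite linsubst_hpart mcoeff_hpart.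
by case: ifP => [_|]; [apply: Uf | rewrite eqxx].
Qed.

(** If m0 is not in U, a polynomial whose product with the monomial m0 lies in the
span of U has zero constant term.
Hence the coefficients at m0 of a cycle modulo U form a cycle of F modulo the
irrelevant ideal, provided the cycle has no other coefficients outside U. *)
Lemma leading_row_cycle U m0 x k (w : 'rV[S]_(grrank F k)) (a : 'rV[K]_(grrank F k)) :
  mupclosed U -> ~~ U m0 -> linsubst Q x = 'X_[m0] ->
  rowin (pullback U) (w - x *: map_mx (@mpolyC n K) a) ->
  cycle_mod (pullback U) w -> tensor_K_cycle a.
Proof.
move=> upU Um0 xQ; have iU := pullback_ideal upU.
case: k w a => // q w a Uwa Uw /=; apply/rowP => j; rewrite !mxE.
have Uxa : pullback U (x * (map_mx (@mpolyC n K) a *m grdiff F q) 0 j).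
  have := idealB iU (Uw j) (rowinM (grdiff F q) iU Uwa j).
  have eqB (u v : 'rV[S]_(grrank F q)) : u 0 j - (u - x *: v) 0 j = x * v 0 j.
    by rewrite !mxE; ring.
  by rewrite mulmxBl -scalemxAl eqB.
have coeffX (g : S) : ('X_[m0] * g)@_m0 = g@_0%MM.
  by have := mcoeffMX g m0 0%MM; rewrite addm0 mulrC.
have := Uxa m0; rewrite rmorphM /= xQ coeffX linsubst_coeff0.
move=> /contra /(_ Um0); rewrite negbK mxE raddf_sum => /eqP eq0.
rewrite -[RHS]eq0; apply: eq_bigr => i _.
by rewrite !mxE; apply/esym/mcoeffCM.
Qed.

Definition Tor_le k (t : int) := forall e, Tor_neq0 F k e -> e <= t.

(** Induction on the number of monomials outside U. Adding to U a monomial m0 of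
maximal degree outside U gives an ideal J' containing J, with J'/J isomorphic to
K shifted by the degree of m0, so Tor_k(S/I, S/J) vanishes in degree c if
Tor_k(S/I, S/J') does in degree c and Tor_k(S/I, K) in degree c - deg m0. *)
Lemma exact_mod_pullback U k (t c : int) :
  mupclosed U -> Tor_le k t -> (forall m, ~~ U m -> t + (mdeg m)%:Z < c) ->
  exact_mod F (pullback U) k c.
Proof.
move=> + tor; pose B := `|c - t|%N.+1.
have [N] := ubnP #|[pred m : 'X_{1..n < B} | ~~ U m]|.
elim: N U => // N IHN U leN upU ltc w hw Uw.
have iU := pullback_ideal upU.
have [[m1 Um1]|allU] := pselect (exists m, ~~ U m); last first.
  exists 0 => j m _; apply: contrapT => /negP nUm; apply: allU; by exists m.
have ltB m : ~~ U m -> (mdeg m < B)%N by move=> /ltc; rewrite /B; lia.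
pose m1' : 'X_{1..n < B} := BMultinom (ltB _ Um1).
have Um1' : ~~ U m1' by [].
(* Maximality of the degree makes U with m0 added stable under multiplication,
   and puts every proper multiple of m0 in U. *)
have [m0 Um0 max0] := 
  @arg_maxnP _ m1' (fun m : 'X_{1..n < B} => ~~ U m) (fun m => mdeg m) Um1'.
have {}max0 m : ~~ U m -> (mdeg m <= mdeg m0)%N.
  by move=> Um; apply: (max0 (BMultinom (ltB _ Um))).
pose V m := U m || (m == m0 :> 'X_{1..n}).
have upV : mupclosed V.
  move=> m m' /orP[Um|/eqP ->]; first by rewrite /V upU.
  rewrite /V; have [->|m'n0] := eqVneq m' 0%MM; first by rewrite addm0 eqxx orbT.
  apply/orP; left; apply: contraT => /max0.
  by rewrite mdegD -[X in (_ <= X)%N]addn0 leq_add2l leqn0 mdeg_eq0 (negPf m'n0).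
have UV : pullback U `<=` pullback V by move=> f Uf m /Uf Um; rewrite /V Um.
have [||v0 Vv0] := IHN V _ upV _ w hw (cycle_modW UV Uw).
- move: leN; rewrite ltnS; apply: leq_trans; apply: proper_card; apply/fintype.properP; split.
    by apply/fintype.subsetP => m; rewrite !inE negb_or => /andP[].
  by exists m0; rewrite !inE // negb_or eqxx andbF.
- by move=> m; rewrite negb_or => /andP[/ltc].
pose v1 := rpart c v0.
have [w1 w1D] : exists w1 : 'rV[S]_(grrank F k), w1 = w - v1 *m grdiff F k by eexists.
have w1E : w1 = rpart c (w - v0 *m grdiff F k).
  apply/rowP => j; rewrite w1D /v1 -(rpart_diff hF) -{1}(rpart_id hw) !mxE hpartD.
  congr (_ + _); apply/mpolyP => m.
  by rewrite mcoeffN !mcoeff_hpart mcoeffN; case: ifP; rewrite ?oppr0.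
have Vw1 : rowin (pullback V) w1.
  by move=> j; rewrite w1E mxE; apply/pullback_hpart/Vv0.
have hw1 : rhomog c w1 by rewrite w1E; apply: rpart_homog.
have Uw1 : cycle_mod (pullback U) w1 by rewrite w1D; exact: (cycle_mod_sub_boundary hF v1 Uw).
(* The correction v1 has made w a cycle w1 in J'; a is its class in J'/J. *)
have [a aE] : exists a : 'rV[K]_(grrank F k),
    forall j, a 0 j = (linsubst Q (w1 0 j))@_m0.
  by exists (\row_j (linsubst Q (w1 0 j))@_m0) => j; rewrite mxE.
pose x : S := linsubst Q' 'X_[m0].
have xQ : linsubst Q x = 'X_[m0] by apply: linsubstK.
pose aS : 'rV[S]_(grrank F k) := map_mx (@mpolyC n K) a.
have Uw1a : rowin (pullback U) (w1 - x *: aS).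
  move=> j m; rewrite !mxE aE rmorphB rmorphM /= linsubstC xQ mcoeffB.
  rewrite mulrC mul_mpolyC mcoeffZ mcoeffX.
  have [<-|ne] := eqVneq (m0 : 'X_{1..n}) m; first by rewrite mulr1 subrr eqxx.
  by rewrite mulr0 subr0 => nz; have := Vw1 j m nz; rewrite /V eq_sym (negPf ne) orbF.
have aC : tensor_K_cycle a by apply: (leading_row_cycle upU Um0 xQ Uw1a).
have [u au] : exists u, a = u *m diff_tensor_K F k.
  apply: contrapT => nau.
  suff /tor : Tor_neq0 F k (c - (mdeg m0)%:Z) by have := ltc _ Um0; lia.
  exists a; split=> // j; apply: contraNeq; rewrite aE.
  rewrite -(hpart_id (hw1 j)) linsubst_hpart mcoeff_hpart.
  case: ifP => [/eqP -> _|_]; last by rewrite eqxx.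
  by apply/eqP; ring.
pose uS : 'rV[S]_(grrank F k.+1) := map_mx (@mpolyC n K) u.
exists (v1 + x *: uS).
have -> : w - (v1 + x *: uS) *m grdiff F k
    = (w1 - x *: aS) + x *: (aS - uS *m grdiff F k).
  by rewrite mulmxDl -scalemxAl scalerBr w1D opprD !addrA subrK.
apply: rowinD => // j m; rewrite mxE rmorphM /= xQ.
move=> /mcoeffM_neq0[b [b' [-> ]]]; rewrite mcoeffX.
have [<- _|_] := eqVneq (m0 : 'X_{1..n}) b; last by rewrite eqxx.
have [->|b'n0 _] := eqVneq b' 0%MM.
  have auj : a 0 j = \sum_i u 0 i * diff_tensor_K F k i j by rewrite {1}au mxE.
  rewrite linsubst_coeff0 !mxE mcoeffB mcoeffC eqxx mulr1.
  rewrite auj raddf_sum -sumrB big1 ?eqxx // => i _.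
  by apply/eqP; rewrite subr_eq0 !mxE; apply/eqP/esym/mcoeffCM.
apply: contraT => /max0.
by rewrite mdegD -[X in (_ <= X)%N]addn0 leq_add2l leqn0 mdeg_eq0 (negPf b'n0).
Qed.

End TopOfTor.

(** * The bound for linear sections *)

Section LinearSections.
Variables (K : fieldType) (r p : nat).
Local Notation n := (r + p)%N.
Local Notation S := {mpoly K[n]}.
Variables (Q Q' : 'M[K]_n).
Hypothesis QQ' : Q *m Q' = 1%:M.
Hypothesis Q'Q : Q' *m Q = 1%:M.

(** The degree in the first r variables, which the substitution by Q maps to the
generators of L. *)
Definition ldeg (m : 'X_{1..n}) := (\sum_(i < r) m (lshift p i))%N.

Definition lforms (i : 'I_r) : S := forms_of_mx Q (lshift p i).

Definition yform (j : 'I_p) : S := forms_of_mx Q (rshift r j).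

Lemma ldegD m m' : ldeg (m + m') = (ldeg m + ldeg m')%N.
Proof. by rewrite /ldeg -big_split; apply: eq_bigr => i _; rewrite mnmDE. Qed.

(** In the coordinates given by Q, the ideal L is generated by variables. *)
Lemma ideal_pow_lforms s :
  ideal_pow (ideal_gen (range lforms)) s = pullback Q' [pred m | (s <= ldeg m)%N].
Proof.
have up k : mupclosed [pred m | (k <= ldeg m)%N].
  by move=> m m' /= le; rewrite ldegD (leq_trans le) ?leq_addr.
apply/seteqP; split; last first.
  move=> f Qf; rewrite -(linsubstK Q'Q f); have {Qf} : monomial_span _ (linsubst Q' f) := Qf.
  move: (linsubst Q' f) => {}f Qf.
  have iP := ideal_pow_ideal s (ideal_gen_ideal (range lforms)).
  rewrite [f]mpolyE linsubst_sum big_seq; apply: ideal_sum => // m.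
  rewrite mcoeff_msupp => /Qf /=; move: (f@_m) => a {Qf f} ls.
  rewrite linsubstZ; apply: ideal_scale => //.
  elim: s m ls {iP} => // s IHs m ls.
  have [i mi] : exists i, m (lshift p i) != 0%N.
    apply: contrapT => nm; move: ls; rewrite /ldeg big1 // => i _.
    by apply/eqP; apply: contraT => mi; case: nm; exists i.
  have -> : m = (U_(lshift p i) + (m - U_(lshift p i)))%MM.
    by rewrite addmC submK // lep1mP.
  rewrite mpolyXD rmorphM /= linsubstX; apply: ideal_powS.
  - exact: ideal_gen_ideal.
  - by apply: sub_ideal_gen; exists i.
  apply: IHs; rewrite -ltnS (leq_trans ls) // -(@submK _ U_(lshift p i)%MM m);
    last by rewrite lep1mP.
  rewrite addmK ldegD addnC -add1n leq_add2r /ldeg (bigD1 i) //= mnm1E eqxx.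
  rewrite big1 // => j /negPf ne.
  by rewrite mnm1E (inj_eq (@lshift_inj _ _)) eq_sym ne.
apply: (@ideal_pow_min _ _ (fun k => pullback Q' [pred m | (k <= ldeg m)%N])).
- by move=> k; apply: pullback_ideal.
- by apply/seteqP; split=> // f _ m.
- apply: ideal_gen_min; first exact: pullback_ideal.
  move=> _ [i _ <-]; rewrite /pullback /= /lforms -linsubstX (linsubstK QQ').
  apply: monomial_spanX; rewrite /= /ldeg (bigD1 i) //= mnm1E eqxx.
  by [].
- move=> k f g; rewrite /pullback /= rmorphM /=; apply: monomial_spanM => a b /= la lb.
  by rewrite ldegD -add1n leq_add.
Qed.

Section Bound.
Variables (I : set S) (F : graded_sequence K n).
Hypothesis hI : homogeneous_ideal I.
Hypothesis hF : graded_free_resolution setT I F.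
Let L := ideal_gen (range lforms).

(** The descending induction on k described at the top of the file, where U k
is the set of monomials that lie in J_k. *)
Theorem linear_section_bound (t : int) (s c : nat) (f : S) :
  contains_irrelevant_power (ideal_add I L) -> Tor_le F p t -> (0 < s)%N ->
  t - p%:Z + s%:Z <= c%:Z -> homog_of_degree c f ->
  ideal_add I (ideal_pow L s) f.
Proof.
move=> [N0 hN0] tor s_gt0 ltc hf; pose N := (N0 * s)%N.
pose U k := [pred m : 'X_{1..n} |
  (s <= ldeg m)%N || [exists j : 'I_p, (j < k)%N && (N <= m (rshift r j))%N]].
have upU k : mupclosed (U k).
  move=> m m' /orP[ls|/existsP[j /andP[jk Nm]]]; rewrite /U /=.
    by rewrite ldegD (leq_trans ls) ?leq_addr.
  by apply/orP; right; apply/existsP; exists j; rewrite jk mnmDE (leq_trans Nm) ?leq_addr.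
have LsE := ideal_pow_lforms s; rewrite -/L in LsE.
have iLs : is_ideal (ideal_pow L s) by apply/ideal_pow_ideal/ideal_gen_ideal.
have U0 : ideal_pow L s = pullback Q' (U 0%N).
  rewrite LsE; congr (pullback Q' _); apply/funext => m /=.
  by rewrite (_ : [exists j, _] = false) ?orbF //; apply/existsP => -[].
have iI : is_ideal I by case: hI.
have yN j : ideal_add I (ideal_pow L s) (yform j ^+ N).
  rewrite /N exprM; apply: ideal_add_exp => //; first exact: ideal_gen_ideal.
  apply/hN0/ideal_pow_exp; first exact: ideal_gen_ideal.
  apply: ideal_sum => [|k _]; first exact: ideal_gen_ideal.
  by apply: ideal_scale; [apply: ideal_gen_ideal|apply: sub_ideal_gen; exists k].
have exact_k i k : (i + k = p)%N -> exact_mod F (pullback Q' (U k)) k (c + k * N)%N%:Z.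
  (* The induction is on i = p - k. *)
  elim: i k => [|i IHi] k.
    rewrite add0n => ->; apply: (exact_mod_pullback hF QQ' (upU p) tor) => m.
    rewrite negb_or -ltnNge negb_exists => /andP[lts /forallP ltN].
    (* A monomial outside U p has degree at most s - 1 in the first variables
       and at most N - 1 in each of the p others. *)
    have le1 : (mdeg m + p <= ldeg m + p * N)%N.
      rewrite mdegE big_split_ord /= -addnA leq_add2l.
      have -> : (p * N = \sum_(j < p) N)%N by rewrite sum_nat_const card_ord.
      have eqp : (\sum_(j < p) 1 = p)%N by rewrite sum1_card card_ord.
      rewrite -[X in (_ + X <= _)%N]eqp -big_split /=; apply: leq_sum => j _.
      by have := ltN j; rewrite ltn_ord /= -ltnNge addn1.
    by move: ltc lts le1; rewrite /ldeg; lia.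
  rewrite addSnnS => eqp; have kp : (k < p)%N by rewrite -eqp leq_addl.
  pose j := Ordinal kp.
  have hy : homog_of_degree N (yform j ^+ N).
    by rewrite -[N%:Z]natz; apply/homog_of_degreeXn/forms_of_mx_homog.
  have yE : linsubst Q' (yform j ^+ N) = 'X_[U_(rshift r j) *+ N].
    by rewrite rmorphXn /= /yform -linsubstX (linsubstK QQ') mpolyXn.
  have iUk := pullback_ideal Q' (upU k).
  apply: (exact_mod_descent hI hF iUk _ hy).
  - by move=> z g; apply: pullback_hpart.
  - have [a Ia [b Lb <-]] := yN j; exists a => //; exists b => //.
    move: Lb; rewrite U0 => Lb m /Lb /=; move=> /orP[->|/existsP[[]]] //.
  - move=> g Jg m gm; have := Jg (U_(rshift r j) *+ N + m)%MM.
    rewrite rmorphM /= yE (mulrC 'X_[_]) mcoeffMX addmC => /(_ gm) /orP[].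
      move=> ls; apply/orP; left; move: ls; rewrite ldegD [ldeg (_ *+ _)]big1 ?addn0 //.
      by move=> i' _; rewrite mulmnE mnm1E eq_rlshift.
    move=> /existsP[j' /andP[j'k le]]; apply/orP; right; apply/existsP; exists j'.
    rewrite j'k /=; move: le; rewrite mnmDE mulmnE mnm1E (inj_eq (@rshift_inj _ _)).
    by rewrite -val_eqE /= gtn_eqF ?mul0n ?addn0.
  have -> : ((c + k * N)%N%:Z + N%:Z) = (c + k.+1 * N)%N%:Z by lia.
  suff -> : ideal_add (pullback Q' (U k)) [set yform j ^+ N * f0 | f0 in setT]
     = pullback Q' (U k.+1) by apply: IHi.
  apply/seteqP; split.
    apply: ideal_add_min; first exact: pullback_ideal.
      move=> g Ug m /Ug /orP[ls|/existsP[j' /andP[j'k le]]]; apply/orP; [by left|right].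
      by apply/existsP; exists j'; rewrite ltnS ltnW.
    move=> _ [g _ <-]; apply: (idealMr _ (pullback_ideal Q' (upU k.+1))).
    rewrite /pullback /= yE; apply: monomial_spanX; apply/orP; right.
    by apply/existsP; exists j; rewrite /= ltnSn mulmnE mnm1E eqxx mul1n leqnn.
  move=> g Ug; rewrite -(linsubstK Q'Q g).
  have iS : is_ideal (ideal_add (pullback Q' (U k)) [set yform j ^+ N * f0 | f0 in setT]).
    apply: ideal_add_ideal => //; split=> [|_ _ [a _ <-] [b _ <-]|a _ [b _ <-]].
    - by exists 0; rewrite ?mulr0.
    - by exists (a + b); rewrite ?mulrDr.
    - by exists (a * b) => //; ring.
  rewrite [linsubst Q' g]mpolyE linsubst_sum big_seq; apply: ideal_sum => // m.
  rewrite mcoeff_msupp => /Ug Um; rewrite linsubstZ; apply: ideal_scale => //.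
  have [Ukm|nUkm] := boolP (U k m).
    exists (linsubst Q 'X_[m]); last by exists 0; rewrite ?addr0 //; exists 0; rewrite ?mulr0.
    by rewrite /pullback /= linsubstK //; apply: monomial_spanX.
  have leN : (N <= m (rshift r j))%N.
    move: Um nUkm; rewrite /U /= => /orP[->//|/existsP[j' /andP[j'k le]]].
    rewrite negb_or negb_exists => /andP[_ /forallP /(_ j')].
    rewrite le andbT -leqNgt => kj'; suff <- : j' = j by [].
    by apply/val_inj/eqP; rewrite eqn_leq -ltnS j'k.
  exists 0; first by case: iUk.
  exists (linsubst Q 'X_[m]); last by rewrite add0r.
  exists (linsubst Q 'X_[m - U_(rshift r j) *+ N]) => //.
  rewrite -[in RHS](@submK _ (U_(rshift r j) *+ N)%MM m).
    by rewrite mpolyXD rmorphM /= -yE linsubstK // mulrC.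
  apply/mnm_lepP => i'; rewrite mulmnE mnm1E.
  by case: eqP => [<-|_]; rewrite ?mul1n ?mul0n.
have := exact_k p 0%N (addn0 p); rewrite mul0n addn0 -U0 => ex0.
case: (hF) => aughom _ surj exact0 _.
have : [set: S] f by []; rewrite {1}surj => -[_ [w _ <-] [g Ig wg]].
pose w0 := rpart c w.
have fE : f = (w0 *m graug F) 0 0 + hpart c g.
  rewrite -(hpart_id hf) -wg hpartD; congr (_ + _); rewrite !mxE hpart_sum.
  by apply: eq_bigr => j _; rewrite (hpartM _ _ (aughom j)) mxE.
have [||v Jv] := ex0 w0; [exact: rpart_homog| by [] |].
exists ((v *m grdiff F 0 *m graug F) 0 0 + hpart c g).
  case: (iI) => _ ID _; apply: ID; last exact: homogeneous_hpart.
  by apply/exact0; exists v.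
exists (((w0 - v *m grdiff F 0) *m graug F) 0 0); first exact: rowinM.
rewrite fE mulmxBl; move: (w0 *m _) (_ *m graug F) => a b.
by rewrite !mxE; ring.
Qed.

End Bound.
End LinearSections.

(** * Powers of the irrelevant ideal *)

Section IrrelevantPowers.
Variables (K : fieldType) (n : nat).
Local Notation S := {mpoly K[n]}.
Local Notation irr := (@irrelevant_ideal K n).
Implicit Types (I J : set S) (f g : S).

Lemma irr_ideal : is_ideal irr. Proof. exact: ideal_gen_ideal. Qed.

Lemma irr_pow_span k : ideal_pow irr k `<=` monomial_span [pred m | (k <= mdeg m)%N].
Proof.
have up j : mupclosed [pred m : 'X_{1..n} | (j <= mdeg m)%N].
  by move=> m m' /= le; rewrite mdegD (leq_trans le) ?leq_addr.
apply: (@ideal_pow_min K n (fun k => monomial_span [pred m | (k <= mdeg m)%N])).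
- by move=> j; apply: monomial_span_ideal.
- by apply/seteqP; split=> // f _ m.
- apply: ideal_gen_min => [|_ [i _ <-]]; first exact: monomial_span_ideal.
  by apply: monomial_spanX; rewrite /= mdeg1.
- move=> j f g; apply: monomial_spanM => a b /= la lb.
  by rewrite mdegD -add1n leq_add.
Qed.

Lemma mdeg_split k (m : 'X_{1..n}) : (k <= mdeg m)%N ->
  exists m1 m2, m = (m1 + m2)%MM /\ mdeg m1 = k.
Proof.
elim: k => [|k IHk] lek; first by exists 0%MM, m; rewrite add0m mdeg0.
have [m1 [m2 [em e1]]] := IHk (ltnW lek).
have [i mi] : exists i, m2 i != 0%N.
  apply: contrapT => nm; move: lek; rewrite em mdegD e1 [mdeg m2]mdegE big1 ?addn0 ?ltnn //.
  by move=> i _; apply/eqP; apply: contraT => mi; case: nm; exists i.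
exists (m1 + U_(i))%MM, (m2 - U_(i))%MM.
by rewrite mdegD e1 mdeg1 addn1 -addmA (addmC U_(i)%MM) submK // lep1mP.
Qed.

Lemma irr_powX (m : 'X_{1..n}) : ideal_pow irr (mdeg m) 'X_[m].
Proof.
have [k] := ubnP (mdeg m); elim: k m => // k IHk m lemk.
have [m0|mn0] := eqVneq (mdeg m) 0%N; first by rewrite m0.
have [|m1 [m2 [em e1]]] := @mdeg_split 1 m; first by rewrite lt0n.
have /mdeg1P[i /eqP m1E] : mdeg m1 == 1%N by rewrite e1.
rewrite em mpolyXD mdegD e1 add1n; apply: ideal_powS; first exact: irr_ideal.
  by rewrite m1E; apply: sub_ideal_gen; exists i.
by apply: IHk; move: lemk; rewrite em mdegD e1 add1n ltnS.
Qed.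

Lemma irr_pow_sub k I :
  is_ideal I -> (forall m, mdeg m = k -> I 'X_[m]) -> ideal_pow irr k `<=` I.
Proof.
move=> iI IX; apply: subset_trans (@irr_pow_span k) _.
apply: monomial_span_sub => // m /= /mdeg_split[m1 [m2 [-> e1]]].
by rewrite mpolyXD; apply: idealMr => //; apply: IX.
Qed.

(** Since membership is tested on homogeneous parts, only degrees at least z
matter; for negative z the power is the unit ideal and all degrees do. *)
Lemma irr_powe_sub (z : int) I : is_ideal I ->
  (forall (c : nat) f, z <= c%:Z -> homog_of_degree c f -> I f) ->
  ideal_powe irr z%:E `<=` I.
Proof.
move=> iI hI f zf; rewrite (sum_hpart f); apply: ideal_sum => // d _.
have [le|lt] := leP z d; first by apply: (hI d) => //; apply: hpart_homog.
suff -> : hpart d f = 0 by case: iI.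
case: z lt zf {hI} => // k lt /irr_pow_span kf.
apply/mpolyP => m; rewrite mcoeff_hpart mcoeff0; case: eqP => // -[em].
by apply/eqP; apply: contraT => /kf /=; rewrite em leqNgt -ltz_nat lt.
Qed.

End IrrelevantPowers.

(** * The bound for independent linear forms *)

Section IndependentForms.
Variables (K : fieldType) (n : nat).
Local Notation S := {mpoly K[n]}.

(** A Gaussian elimination of C gives C = P (1 0) R with P and R invertible, and
the block sum of P with the identity, times R, extends C. *)
Lemma complete_rows r p (C : 'M[K]_(r, r + p)) : row_free C ->
  exists Q Q' : 'M[K]_(r + p),
    [/\ Q *m Q' = 1%:M, Q' *m Q = 1%:M & usubmx Q = C].
Proof.
move=> freeC; pose Q := block_mx (col_ebase C) 0 0 1%:M *m row_ebase C.
have uQ : Q \in unitmx.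
  rewrite unitmx_mul row_ebase_unit andbT unitmxE det_ublock det1 mulr1.
  by rewrite -unitmxE col_ebase_unit.
exists Q, (invmx Q); split; [exact: mulmxV | exact: mulVmx |].
rewrite /Q -mul_usub_mx block_mxEv col_mxKu -[RHS]mulmx_ebase.
have /eqP -> := freeC; rewrite pid_mx_row mul_mx_row.
by rewrite mulmx1 mulmx0.
Qed.

Lemma independent_forms_mx r (l : 'I_r -> S) : independent_forms l ->
  exists2 C : 'M[K]_(r, n), row_free C & l = forms_of_mx C.
Proof.
move=> [lhom lind]; pose C := \matrix_(i < r, j < n) (l i)@_(U_(j)).
have lE : l = forms_of_mx C.
  apply/funext => i; apply/mpolyP => m; rewrite /forms_of_mx raddf_sum /=.
  have [/mdeg1P[j /eqP ->]|m1] := boolP (mdeg m == 1%N).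
    rewrite (bigD1 j) //= mcoeffZ mcoeffXU eqxx mulr1 mxE big1 ?addr0 // => k ne.
    by rewrite mcoeffZ mcoeffXU (negPf ne) mulr0.
  rewrite (dhomog_nemf_coeff (lhom i) m1) big1 // => k _.
  rewrite mcoeffZ mcoeffX; case: eqP => [ek|]; last by rewrite mulr0.
  by rewrite -ek mdeg1 eqxx in m1.
exists C => //; apply: inj_row_free => v vC; apply/rowP => i; rewrite mxE.
apply: (lind (fun i => v 0 i)); rewrite lE /forms_of_mx.
under eq_bigr do rewrite scaler_sumr.
rewrite exchange_big big1 // => j _ /=; under eq_bigr do rewrite scalerA.
have := congr1 (fun A : 'rV_n => A 0 j) vC.
by rewrite -scaler_suml !mxE => ->; rewrite scale0r.
Qed.

End IndependentForms.

Theorem linear_forms_bound (K : fieldType) (n p : nat) (I : set {mpoly K[n]})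
    (F : graded_sequence K n) (t : int) (l : 'I_(n - p) -> {mpoly K[n]}) (s c : nat) f :
  (p <= n)%N -> homogeneous_ideal I -> graded_free_resolution setT I F ->
  Tor_le F p t -> independent_forms l ->
  contains_irrelevant_power (ideal_add I (ideal_gen (range l))) ->
  (0 < s)%N -> t - p%:Z + s%:Z <= c%:Z -> homog_of_degree c f ->
  ideal_add I (ideal_pow (ideal_gen (range l)) s) f.
Proof.
move=> /subnK; move: (n - p)%N l => r l rp; subst n.
move=> hI hF tor /independent_forms_mx[C freeC ->].
have [Q [Q' [QQ' Q'Q <-]]] := complete_rows freeC.
have -> : forms_of_mx (usubmx Q) = lforms Q.
  apply/funext => i; rewrite /lforms /forms_of_mx.
  by apply: eq_bigr => j _; rewrite mxE.
move=> cont s_gt0 ltc hf; exact: (linear_section_bound QQ' Q'Q hI hF cont tor s_gt0 ltc hf).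
Qed.

(** * From resolutions of an ideal to resolutions of its quotient *)

Section LinearResolutions.
Variables (K : fieldType) (n : nat) (I : set {mpoly K[n]}).
Variable G : graded_sequence K n.

(** The resolution G of I, shifted by one position and followed by the inclusion
of I in S. *)
Definition augmented_resolution : graded_sequence K n := {|
  grrank := fun i => if i is j.+1 then grrank G j else 1%N;
  grdeg := fun i =>
    match i return 'I_(if i is j.+1 then grrank G j else 1%N) -> int with
    | 0 => fun=> 0
    | j.+1 => @grdeg K n G j
    end;
  grdiff := fun i =>
    match i return 'M_(grrank G i, if i is j.+1 then grrank G j else 1%N) with
    | 0 => graug G
    | j.+1 => grdiff G j
    end;
  graug := 1%:M |}.

Lemma augmented_resolutionP : is_ideal I ->
  graded_free_resolution I [set 0] G ->
  graded_free_resolution setT I augmented_resolution.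
Proof.
move=> iI [aughom diffhom surj exact0 exactS]; split=> /=.
- move=> j; rewrite (ord1 j) mxE eqxx mulr1n -mpolyX0 => m /mem_msuppXP <-.
  by rewrite mdeg0.
- by case=> [|i] j k //=; rewrite (ord1 k) subr0.
- apply/seteqP; split=> // f _; exists f; last by exists 0; [case: iI|rewrite addr0].
  by exists (const_mx f) => //; rewrite mulmx1 mxE.
- move=> v; rewrite mulmx1 {1}surj; split=> [[_ [w _ <-] [_ -> ]]|[w ->]].
    rewrite addr0 => e; exists w; apply/rowP => j; by rewrite (ord1 j).
  by exists ((w *m graug G) 0 0); [exists w | exists 0; rewrite ?addr0].
- case=> [|i] v //=; rewrite -exact0 /=; split=> [->|e]; first by rewrite mxE.
  by apply/rowP => j; rewrite (ord1 j) e mxE.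
Qed.

Lemma augmented_resolution_Tor_le d q :
  linear_for_steps G d q -> Tor_le augmented_resolution q.+1 (d + q)%N%:Z.
Proof.
move=> lin e [v [ve _ nb]].
have [j vj] : exists j, v 0 j != 0.
  apply: contrapT => nv; apply: nb; exists 0; rewrite mul0mx; apply/rowP => j.
  by rewrite mxE; apply/eqP; apply: contraT => vj; case: nv; exists j.
suff <- : grdeg j = e by rewrite /= (lin q).
by apply/eqP; apply: contraT => /ve /eqP; rewrite (negPf vj).
Qed.

End LinearResolutions.

(** * Cutting down by general linear forms *)

Section GeneralForms.
Variables (K : fieldType) (n : nat).
Hypothesis Kinf : infinite_set [set: K].
Local Notation S := {mpoly K[n]}.
Local Notation irr := (@irrelevant_ideal K n).
Implicit Types (I J P : set S) (f g : S).

Lemma infinite_nonroot (q : {poly K}) : q != 0 -> exists t, ~~ root q t.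
Proof.
move=> q0; apply: contrapT => nt.
have [B _ sB] := infinite_set_fset (size q) Kinf.
have rootB : all (root q) (finmap.enum_fset B).
  by apply/allP => x _; apply: contraT => nx; case: nt; exists x.
have := max_poly_roots q0 rootB (finmap.fset_uniq B).
by rewrite ltnNge => /negP; apply.
Qed.

(** On the line joining a and b both polynomials restrict to nonzero polynomials in
one variable. *)
Lemma common_nonzero k (A B : {mpoly K[k]}) (a b : 'I_k -> K) :
  A.@[a] != 0 -> B.@[b] != 0 -> exists c : 'I_k -> K, A.@[c] != 0 /\ B.@[c] != 0.
Proof.
move=> Aa Bb; pose c t i := a i + (b i - a i) * t.
pose line (D : {mpoly K[k]}) : {poly K} :=
  mmap (@polyC K) (fun i => (a i)%:P + (b i - a i) *: 'X) D.
have lineE D t : (line D).[t] = D.@[c t].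
  rewrite /line /mmap mevalE horner_sum; apply: eq_bigr => m _.
  rewrite hornerM hornerC; congr (_ * _); rewrite /mmap1 horner_prod.
  by apply: eq_bigr => i _; rewrite horner_exp !hornerE.
have nz D t : D.@[c t] != 0 -> line D != 0.
  by rewrite -lineE; apply: contraNneq => ->; rewrite horner0.
have c0 : c 0 =1 a by move=> i; rewrite /c mulr0 addr0.
have c1 : c 1 =1 b by move=> i; rewrite /c mulr1 addrC subrK.
have [|t] := @infinite_nonroot (line A * line B).
  by rewrite mulf_neq0 //; [apply: (nz _ 0) | apply: (nz _ 1)];
    rewrite (meval_eq _ c0, meval_eq _ c1).
rewrite rootE hornerM mulf_eq0 negb_or !lineE => /andP[].
by exists (c t).
Qed.

(** S/I modulo the linear forms with coefficient matrix C has finite length. *)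
Definition cuts I r (C : 'M[K]_(r, n)) :=
  contains_irrelevant_power (ideal_add I (ideal_gen (range (forms_of_mx C)))).

Lemma forms_ideal r (C : 'M[K]_(r, n)) I : is_ideal I ->
  is_ideal (ideal_add I (ideal_gen (range (forms_of_mx C)))).
Proof. by move=> iI; apply: ideal_add_ideal => //; apply: ideal_gen_ideal. Qed.

Definition monomials_of_degree (N : nat) : seq 'X_{1..n} :=
  [seq val m | m <- index_enum ('X_{1..n < N.+1} : finType) & mdeg (val m) == N].

Lemma monomials_of_degree_uniq N : uniq (monomials_of_degree N).
Proof.
by rewrite map_inj_uniq ?filter_uniq ?index_enum_uniq // => x y; apply: val_inj.
Qed.

Lemma mem_monomials_of_degree N m : (m \in monomials_of_degree N) = (mdeg m == N).
Proof.
apply/mapP/eqP => [[m']|dm]; first by rewrite mem_filter => /andP[/eqP dm' _ ->].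
have ltm : (mdeg m < N.+1)%N by rewrite dm.
by exists (BMultinom ltm); rewrite // mem_filter /= dm eqxx mem_index_enum.
Qed.

(** Suppose that I + L contains all forms of degree N when L is given by C0. Write
each monomial of degree N as an element of I plus a combination of the linear
forms given by C0; replacing C0 by C in these expressions gives forms g_i(C) of
degree N in I + L(C). Their coefficient matrix is affine in C and is the identity
for C = C0. Where its determinant is nonzero, the forms g_i(C) span the forms of
degree N. *)
Lemma cuts_open I r (C0 : 'M[K]_(r, n)) : homogeneous_ideal I -> cuts I C0 ->
  exists2 Phi : {mpoly K[r * n]}, Phi.@[fun k => mxvec C0 0 k] != 0 &
    forall C : 'M[K]_(r, n), Phi.@[fun k => mxvec C 0 k] != 0 -> cuts I C.
Proof.
move=> hI [N hN]; have iI : is_ideal I by case: hI.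
pose s := monomials_of_degree N; have s_uniq := monomials_of_degree_uniq N.
have sP m : (m \in s) = (mdeg m == N) by apply: mem_monomials_of_degree.
pose mon (i : 'I_(size s)) := tnth (in_tuple s) i.
have mon_deg i : mdeg (mon i) = N by apply/eqP; rewrite -sP; apply: mem_tnth.
have mon_surj m : mdeg m = N -> exists i, m = mon i.
  by move/eqP; rewrite -sP => /(tnthP (in_tuple s)).
have mon_inj : injective mon by apply/tuple_uniqP.
have /choice[ac hac] : forall i, exists ac : S * ('I_r -> S),
    [/\ I ac.1, homog_of_degree N ac.1, forall j, homog_of_degree (N%:Z - 1) (ac.2 j)
      & 'X_[mon i] = ac.1 + \sum_j ac.2 j * forms_of_mx C0 j].
  move=> i; have : ideal_pow irr N 'X_[mon i] by rewrite -(mon_deg i); apply: irr_powX.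
  move=> /hN[a Ia [b /ideal_gen_range[c ->] e]].
  exists (hpart N a, fun j => hpart (N%:Z - 1) (c j)); split.
  - exact: (homogeneous_hpart _ hI Ia).
  - exact: hpart_homog.
  - by move=> j; apply: hpart_homog.
  rewrite [snd _]/= [fst _]/= -[LHS](@hpart_id _ _ N);
    last by rewrite -(mon_deg i); apply: homog_of_degreeX.
  rewrite -e hpartD hpart_sum; congr (_ + _); apply: eq_bigr => j _.
  by rewrite (hpartM _ _ (@forms_of_mx_homog _ _ _ C0 j)).
pose g (C : 'M[K]_(r, n)) i := (ac i).1 + \sum_j (ac i).2 j * forms_of_mx C j.
(* The matrix of coefficients of the g_i(C), the entries of C being variables. *)
pose A := \matrix_(i < size s, j < size s)
  (((ac i).1@_(mon j))%:MP + \sum_t \sum_k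
     (((ac i).2 t * 'X_k)@_(mon j)) *: 'X_(mxvec_index t k) : {mpoly K[r * n]}).
have AE C : (\det A).@[fun k => mxvec C 0 k] = \det (\matrix_(i, j) (g C i)@_(mon j)).
  rewrite -det_map_mx; congr (\det _); apply/matrixP => i j; rewrite !mxE /=.
  rewrite mevalD mevalC mcoeffD !raddf_sum; congr (_ + _); apply: eq_bigr => t _ /=.
  rewrite raddf_sum /forms_of_mx mulr_sumr raddf_sum; apply: eq_bigr => k _ /=.
  by rewrite mevalZ mevalXU mxvecE -scalerAr mcoeffZ mulrC.
exists (\det A) => [|C]; rewrite AE.
  rewrite (_ : \matrix_(i, j) _ = 1%:M) ?det1 ?oner_eq0 //; apply/matrixP => i j.
  have [_ _ _ e] := hac i.
  by rewrite !mxE /g -e mcoeffX (inj_eq mon_inj).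
set M := \matrix_(i, j) _ => detM.
have uM : M \in unitmx by rewrite unitmxE unitfE.
exists N; apply: irr_pow_sub => [|m' /mon_surj[i ->]]; first exact: forms_ideal.
have hg k : homog_of_degree N (g C k).
  have [_ ha hc _] := hac k => m.
  move=> /msuppD_le; rewrite mem_cat => /orP[/ha //|].
  apply: (homog_of_degree_sum (a := N)) => j _; rewrite -[N%:Z](subrK 1).
  by apply: homog_of_degreeM => //; apply: forms_of_mx_homog.
have -> : 'X_[mon i] = \sum_k invmx M i k *: g C k.
  apply/mpolyP => m; rewrite mcoeffX raddf_sum /=.
  under eq_bigr do rewrite mcoeffZ.
  have [/mon_surj[j ->]|ne] := eqVneq (mdeg m) N.
    have := congr1 (fun B : 'M_(size s) => B i j) (mulVmx uM).
    rewrite !mxE (inj_eq mon_inj) => <-.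
    by apply: eq_bigr => k _; rewrite mxE.
  rewrite big1 => [|k _].
    by case: eqP => // e; rewrite -e mon_deg eqxx in ne.
  have -> : (g C k)@_m = 0; last by rewrite mulr0.
  by apply/eqP; rewrite mcoeff_eq0; apply: contra ne => /hg[->].
apply: ideal_sum => [|k _]; first exact: forms_ideal.
apply: ideal_scale; first exact: forms_ideal.
have [Ia _ _ _] := hac k; exists (ac k).1 => //.
exists (\sum_j (ac k).2 j * forms_of_mx C j) => //.
apply: ideal_sum => [|j _]; first exact: ideal_gen_ideal.
have [_ _ IM] := ideal_gen_ideal (range (forms_of_mx C)).
by apply: IM; apply: sub_ideal_gen; exists j.
Qed.

(** If f and g are outside P, take their homogeneous parts outside P of lowest
degrees a and b: modulo P their product is the part of f g in degree a + b. *)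
Lemma homogeneous_prime P : homogeneous_ideal P -> ~ P 1 ->
  (forall a b f g, homog_of_degree a%:Z f -> homog_of_degree b%:Z g ->
     P (f * g) -> P f \/ P g) -> prime_ideal P.
Proof.
move=> hP P1 primeP; have iP : is_ideal P by case: hP.
split=> // f g Pfg; apply: contrapT => /not_orP[nPf nPg].
have low h : ~ P h ->
    exists d : nat, ~ P (hpart d h) /\ forall i : nat, (i < d)%N -> P (hpart i h).
  move=> nPh; have [d0 nPd0] : exists d : nat, `[< ~ P (hpart d h) >].
    apply: contrapT => nd; apply: nPh; rewrite (sum_hpart h).
    apply: ideal_sum => // d _; apply: contrapT => nP; apply: nd.
    by exists d; apply/asboolP.
  case: (ex_minnP (ex_intro (fun d : nat => `[< ~ P (hpart d h) >]) d0 nPd0)).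
  move=> d /asboolP nPd mind.
  exists d; split=> // i lti; apply: contrapT => /asboolP/mind.
  by rewrite leqNgt lti.
have [a [nPa lowa]] := low f nPf; have [b [nPb lowb]] := low g nPg.
suff : P (hpart a f * hpart b g).
  by move=> /(primeP _ _ _ _ (@hpart_homog _ _ _ _) (@hpart_homog _ _ _ _))[].
(* The upper summation bound exceeds b even when g has size at most b, so that
   the term of index b can be singled out. *)
have eab : hpart (a + b)%N%:Z (f * g) =
    \sum_(i < maxn (msize g) b.+1) hpart ((a + b)%N%:Z - i%:Z) f * hpart i g.
  rewrite {1}(@pihomog_partitionE _ _ mdeg (maxn (msize g) b.+1) g) ?leq_maxl //.
  rewrite mulr_sumr hpart_sum; apply: eq_bigr => i _.
  exact: (hpartM _ _ (@hpart_homog _ _ i g)).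
have ltb : (b < maxn (msize g) b.+1)%N by rewrite leq_max ltnSn orbT.
rewrite (bigD1 (Ordinal ltb)) //= PoszD addrK in eab.
rewrite -(addrK (\sum_(i < maxn (msize g) b.+1 | i != Ordinal ltb)
   hpart ((a%:Z + b%:Z) - i%:Z) f * hpart i g) (_ * _)) -eab.
apply: idealB => //; first exact: (homogeneous_hpart (a + b)%N%:Z hP Pfg).
apply: ideal_sum => // i; rewrite -val_eqE /= neq_ltn => /orP[lti|gti].
  by case: (iP) => _ _ PM; apply/PM/lowb.
apply: idealMr => //; have [lei|gtab] := leqP i (a + b).
  rewrite (_ : a%:Z + b%:Z - i%:Z = (a + b - i)%N%:Z); last by lia.
  by apply: lowa; lia.
have : a%:Z + b%:Z - i%:Z < 0 by lia.
by case: (a%:Z + b%:Z - i%:Z) => //= k _; case: iP.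
Qed.

Lemma homogeneous_add I f d : homogeneous_ideal I -> homog_of_degree d f ->
  homogeneous_ideal (ideal_add I (ideal_gen [set f])).
Proof.
move=> hI hf; have iI : is_ideal I by case: hI.
split; first by apply: ideal_add_ideal => //; apply: ideal_gen_ideal.
move=> _ e [a Ia [_ [k [c [x [fx ->]]]] <-]]; rewrite -[pihomog _ _ _]/(hpart e _) hpartD.
exists (hpart e a); first exact: (homogeneous_hpart e%:Z hI Ia).
exists (hpart e (\sum_(i < k) c i * x i)) => //; rewrite hpart_sum.
exists k, (fun i => hpart (e%:Z - d) (c i)), x; split=> //.
by apply: eq_bigr => i _; rewrite fx; apply: hpartM.
Qed.

Lemma ideal_gen1 f g : ideal_gen [set f] g -> exists h, g = h * f.
Proof.
case=> k [c [x [fx ->]]]; exists (\sum_(i < k) c i).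
by rewrite mulr_suml; apply: eq_bigr => i _; rewrite fx.
Qed.

Definition uncut I r := homogeneous_ideal I /\ forall C : 'M[K]_(r, n), ~ cuts I C.

Lemma uncut_not1 I r : uncut I r -> ~ I 1.
Proof.
move=> [[iI _] nI] I1; apply: (nI 0); exists 0%N => f _.
by apply: sub_ideal_addl; [apply: ideal_gen_ideal | rewrite -[f]mulr1; case: iI => _ _; apply].
Qed.

Lemma uncut_not_irr I r : uncut I r -> ~ irr `<=` I.
Proof.
move=> [[iI _] nI] irrI; apply: (nI 0); exists 1%N => f /irrI.
by apply: sub_ideal_addl; apply: ideal_gen_ideal.
Qed.

(** Zorn's lemma applies because containing a power of the irrelevant ideal
involves only finitely many elements: an ideal that is cut and is the union of a
chain has a member of the chain that is cut. *)
Lemma uncut_maximal I r : uncut I r -> exists P,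
  [/\ I `<=` P, uncut P r & forall J, P `<=` J -> uncut J r -> J = P].
Proof.
move=> uI; have [F FQ Ftot|A [QA maxA]] :=
  (* Adjoining I to each set makes the union of the empty chain uncut as well. *)
  @Zorn_bigcup _ [set A | uncut (I `|` A) r].
  have [[X0 FX0]|/forallNP F0] := pselect (exists X, F X); last first.
    rewrite /= bigcup0 ?setU0 // => X FX; by case: (F0 X).
  have UE f : (I `|` \bigcup_(X in F) X) f <-> exists2 X, F X & (I `|` X) f.
    split=> [[If|[X FX Xf]]|[X FX [If|Xf]]].
    - by exists X0 => //; left.
    - by exists X => //; right.
    - by left.
    - by right; exists X.
  have dir X Y : F X -> F Y ->
      exists2 Z, F Z & (I `|` X `<=` I `|` Z) /\ (I `|` Y `<=` I `|` Z).
    move=> FX FY; have [XY|YX] := Ftot X Y FX FY.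
      by exists Y => //; split=> //; apply: setUS.
    by exists X => //; split=> //; apply: setUS.
  have iX X : F X -> is_ideal (I `|` X) by move=> /FQ[[]].
  split.
    split; first split.
    - by left; case: uI => [[[]]].
    - move=> f g /UE[X FX Xf] /UE[Y FY Yg]; apply/UE.
      have [Z FZ [XZ YZ]] := dir X Y FX FY; exists Z => //.
      by have [_ ZD _] := iX Z FZ; apply: ZD; [apply: XZ | apply: YZ].
    - move=> f g /UE[X FX Xg]; apply/UE; exists X => //.
      by have [_ _ XM] := iX X FX; apply: XM.
    - move=> f d /UE[X FX Xf]; apply/UE; exists X => //.
      by have [[_ XH] _] := FQ X FX; apply: XH.
  move=> C [N hN].
  (* A single member X of the chain serves for any finite list of monomials. *)
  have fin (s : seq 'X_{1..n}) : (forall m, m \in s -> mdeg m = N) ->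
      exists2 X, F X & forall m, m \in s ->
        ideal_add (I `|` X) (ideal_gen (range (forms_of_mx C))) 'X_[m].
    elim: s => [|m s IHs] sN; first by exists X0.
    have [|X FX hX] := IHs; first by move=> m' ms; apply: sN; rewrite inE ms orbT.
    have : ideal_pow irr N 'X_[m] by rewrite -(sN m) ?mem_head //; apply: irr_powX.
    move=> /hN[a /UE[Y FY Ya] [b Lb e]]; have [Z FZ [XZ YZ]] := dir X Y FX FY.
    exists Z => // m'; rewrite inE => /orP[/eqP ->|/hX[a' Xa' hb']].
      by exists a; [apply: YZ | exists b].
    by exists a' => //; apply: XZ.
  have [m|X FX hX] := fin (monomials_of_degree N).
    by rewrite mem_monomials_of_degree => /eqP.
  have [_ /(_ C)] := FQ X FX; apply; exists N; apply: irr_pow_sub => [|m dm].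
    exact/forms_ideal/iX.
  by apply: hX; rewrite mem_monomials_of_degree dm.
exists (I `|` A); split=> [x Ix|//|J AJ uJ]; first by left.
apply/seteqP; split=> // f Jf; apply: contrapT => nAf.
apply: (maxA J).
  split; first by move=> x Ax; apply: AJ; right.
  by move=> JA; apply: nAf; right; apply: JA.
by rewrite /= (setUidr (subset_trans (@subsetUl _ _ _) AJ)).
Qed.

(** If f g lies in the maximal uncut P but neither f nor g does, both P + (f) and
P + (g) are cut, by a common tuple of forms since being cut is an open condition.
The product of the two resulting powers of the irrelevant ideal lies in P plus
the ideal of these forms. *)
Lemma uncut_prime I r : uncut I r -> exists P,
  [/\ I `<=` P, uncut P r & prime_ideal P].
Proof.
move=> /uncut_maximal[P [IP uP maxP]]; exists P; split=> //.
have [hP nP] := uP; have iP : is_ideal P by case: hP.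
apply: homogeneous_prime => // [|a b f g hf hg Pfg]; first exact: uncut_not1 uP.
have enlarge d h : homog_of_degree d h -> ~ P h ->
    exists2 C : 'M[K]_(r, n), homogeneous_ideal (ideal_add P (ideal_gen [set h]))
      & cuts (ideal_add P (ideal_gen [set h])) C.
  move=> hh nPh; have hom := homogeneous_add hP hh.
  apply: contrapT => nC; apply: nPh; rewrite -(maxP (ideal_add P (ideal_gen [set h]))).
  - by apply: sub_ideal_addr => //; apply: sub_ideal_gen.
  - by apply: sub_ideal_addl; apply: ideal_gen_ideal.
  - by split=> // C cC; apply: nC; exists C.
apply: contrapT => /not_orP[nPf nPg].
have [C1 hf1 /(cuts_open hf1)[A A1 cA]] := enlarge _ _ hf nPf.
have [C2 hg2 /(cuts_open hg2)[B B2 cB]] := enlarge _ _ hg nPg.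
have [c [Ac Bc]] := common_nonzero A1 B2.
pose C : 'M[K]_(r, n) := vec_mx (\row_k c k).
have Cc : (fun k => mxvec C 0 k) =1 c by move=> k; rewrite vec_mxK mxE.
have [N1 h1] : cuts (ideal_add P (ideal_gen [set f])) C by apply: cA; rewrite (meval_eq _ Cc).
have [N2 h2] : cuts (ideal_add P (ideal_gen [set g])) C by apply: cB; rewrite (meval_eq _ Cc).
apply: (nP C); exists (N1 + N2)%N; apply: irr_pow_sub => [|m dm]; first exact: forms_ideal.
have [|m1 [m2 [em e1]]] := @mdeg_split n N1 m; first by rewrite dm leq_addr.
have e2 : mdeg m2 = N2 by move: dm; rewrite em mdegD e1 => /addnI.
have : ideal_pow irr N1 'X_[m1] by rewrite -e1; apply: irr_powX.
move=> /h1[_ [u Pu [_ /ideal_gen1[x ->] <-]] [l Ll E1]].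
have : ideal_pow irr N2 'X_[m2] by rewrite -e2; apply: irr_powX.
move=> /h2[_ [v Pv [_ /ideal_gen1[y ->] <-]] [l' Ll' E2]].
exists (u * 'X_[m2] + x * f * v + x * y * (f * g)).
  case: (iP) => _ PD PM; apply: (PD); last exact: (PM).
  by apply: (PD); [apply: idealMr | apply: (PM)].
exists (l * 'X_[m2] + x * f * l').
  have [_ LD LM] := ideal_gen_ideal (range (forms_of_mx C)).
  by apply: LD; [apply: idealMr => //; apply: ideal_gen_ideal | apply: LM].
by rewrite em mpolyXD -E1 -E2; ring.
Qed.

Lemma irrP f : irr f <-> f@_0%MM = 0.
Proof.
split=> [|f0].
  apply: (@ideal_gen_min _ _ _ [set f : S | f@_0%MM = 0]) => [|_ [i _ <-]] /=.
    split=> /= [|x y|x y]; first by rewrite mcoeff0.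
      by move=> x0 y0; rewrite mcoeffD x0 y0 addr0.
    by move=> y0; rewrite rmorphM /= y0 mulr0.
  by rewrite mcoeffX mnm1_eq0.
suff : monomial_span [pred m | m != 0%MM] f.
  apply: (monomial_span_sub (@irr_ideal K n)) => m /=; rewrite -mdeg_eq0 -lt0n.
  move=> /mdeg_split[m1 [m2 [-> e1]]]; rewrite mpolyXD; apply: idealMr; first exact: irr_ideal.
  by rewrite -[irr]/(ideal_pow irr 1) -e1; apply: irr_powX.
by move=> m; apply: contraNneq => ->; apply/eqP.
Qed.

Lemma irr_prime : prime_ideal irr.
Proof.
split; first exact: irr_ideal.
  by move=> /irrP/eqP; rewrite mcoeff1 eqxx oner_eq0.
move=> f g /irrP; rewrite rmorphM => /eqP; rewrite mulf_eq0 => /orP[]/eqP e.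
  by left; apply/irrP.
by right; apply/irrP.
Qed.

Lemma homogeneous_sub_irr P : homogeneous_ideal P -> ~ P 1 -> P `<=` irr.
Proof.
move=> hP P1 f Pf; apply/irrP; apply: contrapT => /eqP f0; apply: P1.
have : P (hpart 0 f) by apply: homogeneous_hpart.
have -> : hpart 0 f = (f@_0%MM)%:MP.
  apply/mpolyP => m; rewrite mcoeff_hpart mcoeffC eqz_nat mdeg_eq0.
  by case: eqP => [->|_]; rewrite ?mulr1 ?mulr0.
case: hP => iP _ /(ideal_scale (f@_0%MM)^-1 iP).
by rewrite -mul_mpolyC -mpolyCM mulVf.
Qed.

(** The chain P 0, ..., P r.+1 has length r + 1. Its last member is the irrelevant
ideal, and P 0 is a maximal uncut ideal above I. If the variable x_k is outside
P 0, then P 0 + (x_k) is uncut for one form less, as x_k itself can serve as a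
form; the rest of the chain is above P 0 + (x_k). *)
Lemma uncut_chain r I : uncut I r -> exists P : nat -> set S,
  (forall i, (i <= r.+1)%N -> prime_ideal (P i) /\ I `<=` P i) /\
  (forall i, (i < r.+1)%N -> P i `<` P i.+1).
Proof.
elim: r I => [|r IHr] I /uncut_prime[P0 [IP0 uP0 primeP0]].
  have P0irr : P0 `<=` irr.
    by apply: homogeneous_sub_irr; [case: uP0 | apply: uncut_not1 uP0].
  exists (fun i => if i is 0 then P0 else irr); split=> -[|[|]] //= _.
    by split; [exact: irr_prime | apply: subset_trans P0irr].
  by split=> //; apply: uncut_not_irr uP0.
have [k nPk] : exists k : 'I_n, ~ P0 'X_k.
  apply: contrapT => nk; apply: (uncut_not_irr uP0); apply: ideal_gen_min.
    by case: uP0 => [[]].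
  by move=> _ [k _ <-]; apply: contrapT => nPk; apply: nk; exists k.
have [hP0 nP0] := uP0; have iP0 : is_ideal P0 by case: hP0.
pose J := ideal_add P0 (ideal_gen [set 'X_k]).
have P0J : P0 `<=` J by apply: sub_ideal_addl; apply: ideal_gen_ideal.
have Jk : J 'X_k by apply: sub_ideal_addr => //; apply: sub_ideal_gen.
have [|P [primeP chainP]] := IHr J.
  split; first by apply: (homogeneous_add hP0 (@homog_of_degreeX _ _ U_(k)%MM)).
  move=> C [N hN]; apply: (nP0 (col_mx (delta_mx 0 k) C : 'M_(1 + r, n))).
  exists N; apply: subset_trans hN _.
  set C' : 'M_(1 + r, n) := col_mx _ _.
  have iC' : is_ideal (ideal_add P0 (ideal_gen (range (forms_of_mx C')))).
    exact: forms_ideal.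
  have LC' (i : 'I_(1 + r)) :
      ideal_add P0 (ideal_gen (range (forms_of_mx C'))) (forms_of_mx C' i).
    by apply: sub_ideal_addr => //; apply: sub_ideal_gen; exists i.
  apply: ideal_add_min => //.
    apply: ideal_add_min => //; first by apply: sub_ideal_addl; apply: ideal_gen_ideal.
    apply: ideal_gen_min => // _ ->; have := LC' (lshift r 0).
    rewrite /forms_of_mx (bigD1 k) //= col_mxEu mxE !eqxx scale1r.
    rewrite big1 ?addr0 // => j /negPf ne.
    by rewrite col_mxEu mxE ne andbF scale0r.
  apply: ideal_gen_min => // _ [i _ <-]; have := LC' (rshift 1 i).
  suff -> : forms_of_mx C' (rshift 1 i) = forms_of_mx C i by [].
  by apply: eq_bigr => j _; rewrite col_mxEd.
exists (fun i => if i is j.+1 then P j else P0); split=> -[|i] lei //=.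
- have [prime_i JPi] := primeP i lei; split=> //.
  by apply: subset_trans JPi; apply: subset_trans P0J.
- have [_ JP] := primeP 0%N isT; split; first exact: subset_trans JP.
  by move=> PP0; apply: nPk; apply/PP0/JP.
- exact: chainP.
Qed.

Theorem general_forms_cut I (p : nat) (c : \bar int) :
  (p <= n)%N -> homogeneous_ideal I -> is_codim I c -> (p%:Z%:E <= c)%E ->
  for_general_forms (fun l : 'I_(n - p) -> S =>
    contains_irrelevant_power (ideal_add I (ideal_gen (range l)))).
Proof.
move=> lepn hI [D [supD _] ->] lec.
have [C0 cutC0] : exists C : 'M[K]_(n - p, n), cuts I C.
  apply: contrapT => nC.
  have [|P [primeP chainP]] := @uncut_chain (n - p) I.
    by split=> // C cC; apply: nC; exists C.
  have : ((n - p).+1%:Z%:E <= D)%E by apply: supD; exists (n - p).+1, P.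
  case: D lec {supD} => [d| |] //=; rewrite !lee_fin; lia.
have [Phi Phi0 hPhi] := cuts_open hI cutC0.
exists Phi; last by move=> C; apply: hPhi.
by apply: contraNneq Phi0 => ->; rewrite meval0.
Qed.

End GeneralForms.

(** * The theorem *)

Theorem corollary5p2 (K : fieldType) (n : nat) (I : set {mpoly K[n]})
    (hI : homogeneous_ideal I) (p : nat) (hp : (p <= n)%N) :
  (forall (F : graded_sequence K n) (m : \bar int),
     is_t setT I F p m ->
   forall l : 'I_(n - p) -> {mpoly K[n]}, independent_forms l ->
   let L := ideal_gen (range l) in
   contains_irrelevant_power (ideal_add I L) ->
     ideal_powe irrelevant_ideal (m - p%:Z%:E + 1%:E)%E `<=` ideal_add I L /\
     forall s : nat, (1 <= s)%N ->
       ideal_powe irrelevant_ideal (m - p%:Z%:E + s%:Z%:E)%E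
         `<=` ideal_add I (ideal_pow L s)) /\
  (infinite_set [set: K] ->
   forall c : \bar int, is_codim I c -> (p%:Z%:E <= c)%E ->
   for_general_forms (fun l : 'I_(n - p) -> {mpoly K[n]} =>
     contains_irrelevant_power (ideal_add I (ideal_gen (range l))))) /\
  ((1 <= p)%N ->
   forall l : 'I_(n - p) -> {mpoly K[n]}, independent_forms l ->
   let L := ideal_gen (range l) in
   contains_irrelevant_power (ideal_add I L) ->
   forall (d : nat) (G : graded_sequence K n),
     generated_in_degree d I ->
     minimal_resolution I [set 0] G ->
     linear_for_steps G d p.-1 ->
     ideal_pow irrelevant_ideal d `<=` ideal_add I L).
Proof.
have iI : is_ideal I by case: hI.
split; [|split].
- move=> F m [hF [supm _]] l lind L cont.
  suff main s : (1 <= s)%N ->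
      ideal_powe irrelevant_ideal (m - p%:Z%:E + s%:Z%:E)%E `<=` ideal_add I (ideal_pow L s).
    by split=> [|s]; [apply: (main 1%N) | apply: main].
  have iIL : is_ideal (ideal_add I (ideal_pow L s)).
    by apply: ideal_add_ideal => //; apply/ideal_pow_ideal/ideal_gen_ideal.
  move=> s_gt0; have bound t c f := @linear_forms_bound K n p I F t l s c f hp hI hF.
  case: m supm => [t|Tor_oo f ->|noTor f _]; last 2 first.
  + by case: iIL.
  + rewrite (sum_hpart f); apply: ideal_sum => // c _.
    apply: (bound (c%:Z + p%:Z - s%:Z) c) => //; last exact: hpart_homog.
      by move=> e /noTor.
    by lia.
  move=> tor; apply: irr_powe_sub => // c f ltc hf.
  by apply: (bound t c) => // e /tor; rewrite lee_fin.
- by move=> Kinf c; apply: general_forms_cut.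
- move=> p_gt0 l lind L cont d G _ [resG _] linG.
  have resF := augmented_resolutionP iI resG.
  have tor : Tor_le (augmented_resolution G) p (d + p.-1)%N%:Z.
    by rewrite -{1}(prednK p_gt0); apply: augmented_resolution_Tor_le.
  apply: (@irr_powe_sub K n d%:Z) => [|c f ledc hf].
    by apply: ideal_add_ideal => //; apply: ideal_gen_ideal.
  apply: (@linear_forms_bound K n p I _ _ l 1%N c f hp hI resF tor) => //.
  by move: ledc p_gt0; lia.
Qed.
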